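(* Let $\alpha_1,\alpha_2>0$ be such that $$\alpha_1<\alpha_2<\alpha_1+1/2.$$ Let $c_1>0$, $c_2\in\mathbb{R}$, and let $\{\mu_n\}_{n\in\mathbb{N}^*}$ be a non-increasing sequence of positive real numbers such that $$\mu_n=\frac{c_1}{n^{\alpha_1}}+\frac{c_2}{n^{\alpha_2}}+o_{n\to\infty}\left(\frac{1}{n^{\alpha_2}}\right).$$ Let $\mathcal{E}_2$ be the $2$-ellipsoid with semi-axes $\{\mu_n\}_{n\in\mathbb{N}^*}$. Then $$H\left(\varepsilon;\mathcal{E}_2,\|\cdot\|_2\right)=\frac{\alpha_1c_1^{\frac{1}{\alpha_1}}}{\ln(2)}\,\varepsilon^{-\frac{1}{\alpha_1}}+\frac{c_2\,c_1^{\frac{1-\alpha_2}{\alpha_1}}}{\ln(2)(\alpha_1-\alpha_2+1)}\,\varepsilon^{-\frac{\alpha_1-\alpha_2+1}{\alpha_1}}+o_{\varepsilon\to0}\left(\varepsilon^{-\frac{\alpha_1-\alpha_2+1}{\alpha_1}}\right).$$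
   Context: $\mathbb{N}^*=\{1,2,\dots\}$. $\mathcal{E}_2=\{x\in\ell^2(\mathbb{N}^*;\mathbb{R}):\sum_{n\ge1}|x_n/\mu_n|^2\le1\}$. The covering number $N(\varepsilon;\mathcal{E}_2,\|\cdot\|_2)$ is the smallest cardinality of a finite set of points of $\ell^2$ such that each $x\in\mathcal{E}_2$ is within $\ell^2$-distance at most $\varepsilon$ of one of them, and $H(\varepsilon;\mathcal{E}_2,\|\cdot\|_2)=\log N(\varepsilon;\mathcal{E}_2,\|\cdot\|_2)$ with $\log$ the logarithm to base 2; $\ln$ is the natural logarithm. *)

(* Defs.v *)
From HB Require Import structures.
From mathcomp Require Import all_boot all_order all_algebra.
From mathcomp Require Import all_classical all_reals all_analysis.

Set Implicit Arguments.
Unset Strict Implicit.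
Unset Printing Implicit Defensive.

Import Order.TTheory GRing.Theory Num.Theory.
Import numFieldNormedType.Exports.

Local Open Scope classical_set_scope.
Local Open Scope ring_scope.

(* A sequence (u_n) indexed by n = 1, 2, ... is encoded as u : nat -> R, where
   u k is the term of index n = k + 1. *)

Definition l2norm (R : realType) (x : nat -> R) : \bar R :=
  'N[counting]_2%:E[EFin \o x]%E.

(* No measurability condition: every function on nat is measurable. *)
Definition l2 (R : realType) : set (nat -> R) := [set x | (l2norm x < +oo)%E].

Definition ellipsoid2 (R : realType) (mu : nat -> R) : set (nat -> R) :=
  [set x | l2 x /\
    (\sum_(0 <= k <oo) ((`|x k / mu k| ^+ 2)%:E) <= 1%:E)%E].

Definition is_covering (R : realType) (eps : R) (K A : set (nat -> R)) : Prop :=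
  A `<=` @l2 R /\
  forall x, K x -> exists2 y, A y & (l2norm (x \- y)%R <= eps%:E)%E.

(* The infimum is over a set of natural numbers, hence it is attained as soon
   as some finite covering exists; it is +oo otherwise. *)
Definition covering_number (R : realType) (eps : R) (K : set (nat -> R)) :
    \bar R :=
  ereal_inf [set (N%:R)%:E | N in
    [set N : nat | exists A, (A #= `I_N)%card /\ is_covering eps K A]].

Definition metric_entropy (R : realType) (eps : R) (K : set (nat -> R)) :
    \bar R :=
  (lne (covering_number eps K) * ((ln 2)^-1)%R%:E)%E.

(* Main.v *)
(* Write M for the number of semi-axes larger than eps and S(eps) for the sum of
   ln (mu_n / eps) over them; ln N(eps) = S(eps) + O(sqrt M ln M).

   Both bounds use independent Gaussian coordinates under an exponential tilt.
   For the lower bound, each ball is dominated by exp (la (eps^2 - |x - y|^2))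
   with la = d / (2 eps^2), while the part of the ellipsoid near its boundary
   carries at least half of the mass of a slightly shrunk Gaussian. For the upper bound, split the
   coordinates into J blocks on which eps^2 / mu_n^2 varies by at most 1 / J. If
   a point has energy sum (x_n / mu_n)^2 = T on a block with k coordinates, draw
   the centre with variances (T / k) (mu_n^2 - eps^2) there; tilting by
   la = k / (2 eps^2 T) turns the distance of the block into eps sqrt T, and the
   block costs the product of the mu_n / eps whatever T is. A greedy choice then
   derandomizes, and the energy profiles contribute only O(J ln J), so that
   J ~ sqrt M balances the errors. Gaussian integrals over R^d are replaced by
   Riemann sums over finite grids, for which Fubini's theorem is the
   distributivity of products over sums.

   Finally eps = c1 x^(-a1) makes S(eps) equal to
   a1 (d ln x - ln d!) + sum_(n <= d) ln (mu_n n^a1 / c1), whose first part is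
   a1 x up to O(ln x) and whose second part is (c2 / c1) d^p / p + o(d^p) with
   p = a1 - a2 + 1 > 1 / 2, so that the O(sqrt x ln x) errors are negligible. *)

Require Import Defs.
From HB Require Import structures.
From mathcomp Require Import all_boot all_order all_algebra.
From mathcomp Require Import all_classical all_reals all_analysis.
From mathcomp Require Import measurable_realfun ring lra.

Set Implicit Arguments.
Unset Strict Implicit.
Unset Printing Implicit Defensive.

Import Order.TTheory GRing.Theory Num.Theory.
Import numFieldNormedType.Exports.

Local Open Scope classical_set_scope.
Local Open Scope ring_scope.

(** * Riemann sums of Gaussian functions *)

Lemma is_derive_increment (R : realType) (f df : R -> R) (x y : R) : x <= y ->
  (forall z : R, is_derive z 1 f (df z)) ->
  exists2 z, x <= z <= y & f y - f x = df z * (y - x).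
Proof.
move=> xy dfE; have [|z] := @MVT_segment R f df x y xy.
- apply: derivable_within_continuous => z _.
  by have [] := dfE z.
- by rewrite in_itv/=; exists z.
Qed.

Lemma is_derive_gauss_fun (R : realType) (x : R) :
  is_derive x 1 (@gauss_fun R) (- (2 * x) * gauss_fun x).
Proof.
rewrite /gauss_fun.
have d2 : is_derive x (1:R) (fun x : R => - x ^+ 2) (- (2 * x)).
  have /is_derive_eq := is_deriveN (is_deriveX 2 (is_derive_id x (1:R))).
  by apply; rewrite /GRing.scale/= expr1 mulr1.
have := @is_derive1_comp R (@expR R) (fun x : R => - x ^+ 2) x _ _ _ d2.
by move=> /(_ _ (is_derive_expR _)); rewrite mulrC.
Qed.

(** The derivative is at most 1 in absolute value because [2 |z| <= 1 + z^2 <= exp (z^2)]. *)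
Lemma gauss_fun_lipschitz (R : realType) (x y : R) : x <= y ->
  `|gauss_fun y - gauss_fun x| <= y - x.
Proof.
move=> xy.
have [z _ ->] := is_derive_increment xy (@is_derive_gauss_fun R).
rewrite normrM (ger0_norm (_ : 0 <= y - x)) ?subr_ge0//.
rewrite -[leRHS]mul1r ler_wpM2r ?subr_ge0//.
rewrite normrM (ger0_norm (gauss_fun_ge0 _)) normrN /gauss_fun expRN.
rewrite ler_pdivrMr ?expR_gt0// mul1r.
apply: le_trans (expR_ge1Dx _).
rewrite -[z ^+ 2]real_normK ?num_real//.
rewrite normrM [`|2|]ger0_norm//.
by rewrite -subr_ge0 (_ : _ - _ = (`|z| - 1) ^+ 2) ?sqr_ge0//; ring.
Qed.

(** The integral from [-oo] is monotone and bounded, so it has limits at both ends; they differ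
    because its increment over [0, 1] is positive. *)
Lemma gauss_primitive (R : realType) :
  exists (G : R -> R), (forall x : R, is_derive x 1 G (gauss_fun x)) /\
  exists l u : R, [/\ l < u, G x @[x --> +oo] --> u & G (- x) @[x --> +oo] --> l].
Proof.
pose mu : {measure set (measurableTypeR R) -> \bar R} := @lebesgue_measure R.
pose G (y : R) : R := \int[mu]_(t in [set` Interval -oo%O (BRight y)]) gauss_fun t.
have intG (A : set R) : measurable A -> mu.-integrable A (EFin \o @gauss_fun R).
  by move=> mA; apply: (integrableS measurableT) => //; exact: integrableT_gauss.
have dG (x : R) : is_derive x 1 G (gauss_fun x).
  have [||||d1 d2] := @continuous_FTC1 R (@gauss_fun R) -oo%O x (x + 1).
  - by rewrite ltrDl.
  - by apply: intG; exact: measurable_itv.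
  - by rewrite ltNyr.
  - exact: continuous_gauss_fun.
  - by apply: DeriveDef; [exact: d1|rewrite -derive1E; exact: d2].
have ndG : {homo G : x y / x <= y}.
  move=> x y xy; have [z _ E] := is_derive_increment xy dG.
  by rewrite -subr_ge0 E mulr_ge0 ?gauss_fun_ge0// subr_ge0.
have G0 y : 0 <= G y by apply: Rintegral_ge0 => x _; exact: gauss_fun_ge0.
have GT y : G y <= \int[mu]_x gauss_fun x.
  have mI : measurable [set` Interval -oo%O (BRight y)] by exact: measurable_itv.
  rewrite /G /Rintegral fine_le//.
  - by apply: integrable_fin_num => //; exact: intG.
  - by apply: integrable_fin_num => //; exact: intG.
  apply: ge0_subset_integral => //.
    by apply/measurable_EFinP; exact: measurable_gauss_fun.
  by move=> x _; rewrite lee_fin gauss_fun_ge0.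
have ubG : has_ubound (range G).
  by exists (\int[mu]_x gauss_fun x) => _ [x _ <-].
have ubN : has_ubound (range (fun x => - G (- x))).
  by exists 0 => _ [x _ <-]; rewrite oppr_le0.
have c1 := nondecreasing_cvgr ndG ubG.
have ndN : nondecreasing_fun (fun x => - G (- x)).
  by move=> x y xy; rewrite lerN2 ndG// lerN2.
have c2 := nondecreasing_cvgr ndN ubN.
exists G; split=> //.
exists (- sup (range (fun x : R => - G (- x)))), (sup (range G)).
have h2 : G 1 <= sup (range G) by apply: (ub_le_sup ubG); exists 1.
have h0 : - sup (range (fun x : R => - G (- x))) <= G 0.
  by rewrite lerNl; apply: (ub_le_sup ubN); exists 0; rewrite ?oppr0.
have [z _ E] := is_derive_increment (@ler01 R) dG.
have G01 : 0 < G 1 - G 0 by rewrite E subr0 mulr1 expR_gt0.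
split => //; first by lra.
have := cvgN c2; under [X in X @ _]eq_fun do rewrite opprK.
exact.
Qed.

(** The [2 M^3] points of mesh [1 / M^2] run through [-M, M): the window grows, while [2 M^3] cells
    with errors of order [M^-4] add up to only O(1 / M). *)
Definition grid_pt (R : realType) (M k : nat) : R := k%:R / M%:R ^+ 2 - M%:R.

Definition gauss_sum (R : realType) (M : nat) (a b : R) : R :=
  (M%:R ^+ 2)^-1 *
  \sum_(k < (2 * M ^ 3)%N) expR (- (a * (grid_pt R M k - b) ^+ 2)).

Lemma gauss_primitive_cell (R : realType) (G : R -> R) (x y : R) :
  (forall z : R, is_derive z 1 G (gauss_fun z)) -> x <= y ->
  `|(y - x) * gauss_fun x - (G y - G x)| <= (y - x) ^+ 2.
Proof.
move=> dG xy; have [z /andP[xz zy] ->] := is_derive_increment xy dG.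
rewrite [gauss_fun z * _]mulrC -mulrBr normrM expr2 ger0_norm ?subr_ge0//.
rewrite ler_wpM2l ?subr_ge0// distrC (le_trans (gauss_fun_lipschitz xz))//.
by rewrite lerB.
Qed.

(** With [z = sqrt a (y - b)] the sum becomes a left Riemann sum of [gauss_fun] with cells of length
    [sqrt a / M^2], each of which errs by at most [a / M^4]. *)
Lemma gauss_sum_err (R : realType) (G : R -> R) (M : nat) (a b : R) :
  (forall z : R, is_derive z 1 G (gauss_fun z)) -> 0 < a -> (0 < M)%N ->
  `|Num.sqrt a * gauss_sum M a b
    - (G (Num.sqrt a * (M%:R - b)) - G (- (Num.sqrt a * (M%:R + b))))|
  <= 2 * a / M%:R.
Proof.
move=> dG a0 M0; set s := Num.sqrt a.
have M0' : M%:R != 0 :> R by rewrite pnatr_eq0 -lt0n.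
have Mgt0 : 0 < M%:R :> R by rewrite ltr0n.
have s0 : 0 < s by rewrite sqrtr_gt0.
have s2 : s ^+ 2 = a by rewrite sqr_sqrtr// ltW.
pose z (k : nat) : R := s * (grid_pt R M k - b).
have zS k : z k.+1 - z k = s / M%:R ^+ 2.
  by rewrite /z /grid_pt -[k.+1]addn1 natrD; field.
have -> : G (s * (M%:R - b)) - G (- (s * (M%:R + b))) =
    \sum_(0 <= k < (2 * M ^ 3)%N) (G (z k.+1) - G (z k)).
  rewrite telescope_sumr//; congr (G _ - G _).
    by rewrite /z /grid_pt natrM natrX; field.
  by rewrite /z /grid_pt mul0r; ring.
have -> : s * gauss_sum M a b =
    \sum_(0 <= k < (2 * M ^ 3)%N) (z k.+1 - z k) * gauss_fun (z k).
  rewrite /gauss_sum mulrA mulr_sumr big_mkord; apply: eq_bigr => k _.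
  by rewrite zS /gauss_fun /z exprMn s2.
rewrite -sumrB (le_trans (ler_norm_sum _ _ _))//.
apply: (@le_trans _ _ (\sum_(0 <= k < (2 * M ^ 3)%N) (s / M%:R ^+ 2) ^+ 2)).
  apply: ler_sum => k _; rewrite -(zS k); apply: gauss_primitive_cell => //.
  by rewrite -subr_ge0 zS divr_ge0// ltW.
rewrite sumr_const_nat subn0 -[leLHS]mulr_natl natrM natrX exprMn s2 exprVn.
by rewrite le_eqVlt; apply/orP; left; apply/eqP; field.
Qed.

(** [c] plays the role of sqrt pi. It is chosen before [a] and [b], so that it cancels when Gaussian
    masses with different parameters are compared. *)
Lemma cvg_gauss_sum (R : realType) : exists2 c : R, 0 < c &
  forall a b : R, 0 < a -> gauss_sum M a b @[M --> \oo] --> c / Num.sqrt a.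
Proof.
have [G [dG [l [u [lu Gu Gl]]]]] := gauss_primitive R.
exists (u - l); first by rewrite subr_gt0.
move=> a b a0.
have s0 : 0 < Num.sqrt a by rewrite sqrtr_gt0.
have lin (e : R) : Num.sqrt a * (M%:R + e) @[M --> \oo] --> +oo.
  apply/cvgryPge => A; near=> M.
  rewrite -ler_pdivrMl// -lerBlDr.
  by near: M; exact: nbhs_infty_ger.
have cG : G (Num.sqrt a * (M%:R - b)) - G (- (Num.sqrt a * (M%:R + b)))
    @[M --> \oo] --> u - l.
  apply: cvgB; first exact: (cvg_comp _ _ (lin (- b)) Gu).
  exact: (cvg_comp _ _ (lin b) Gl).
have c0 : Num.sqrt a * gauss_sum M a b
    - (G (Num.sqrt a * (M%:R - b)) - G (- (Num.sqrt a * (M%:R + b))))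
    @[M --> \oo] --> 0.
  apply/cvgr0Pnorm_le => e e0; near=> M.
  have M0 : (0 < M)%N by near: M; exact: nbhs_infty_gt.
  apply: le_trans (gauss_sum_err _ dG a0 M0) _.
  rewrite ler_pdivrMr ?ltr0n// -ler_pdivrMl//.
  by near: M; exact: nbhs_infty_ger.
have := cvgMl_tmp (a := (Num.sqrt a)^-1) (cvgD c0 cG).
rewrite add0r [_ * (u - l)]mulrC => cM.
apply: (cvg_trans _ (cM _ _)); apply: near_eq_cvg; near=> M.
by rewrite /= fctE subrK mulKf ?gt_eqF.
Unshelve. all: by end_near. Qed.

(** * Sums over finite grids and greedy coverings *)

(** Stands for the integral of [F] over R^d, approached as [M] tends to infinity. *)
Definition grid_sum (R : realType) (d M : nat) (F : ('I_d -> R) -> R) : R :=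
  ((M%:R ^+ 2)^-1) ^+ d *
  \sum_(f : {ffun 'I_d -> 'I_(2 * M ^ 3)}) F (fun n => grid_pt R M (f n)).

Lemma ler_grid_sum (R : realType) (d M : nat) (F G : ('I_d -> R) -> R) :
  (forall x, F x <= G x) -> grid_sum M F <= grid_sum M G.
Proof.
move=> FG; rewrite ler_wpM2l ?exprn_ge0 ?invr_ge0 ?sqr_ge0//.
by apply: ler_sum => f _; exact: FG.
Qed.

Lemma grid_sumZ (R : realType) (d M : nat) (k : R) (F : ('I_d -> R) -> R) :
  grid_sum M (fun x => k * F x) = k * grid_sum M F.
Proof. by rewrite /grid_sum -mulr_sumr mulrCA. Qed.

Lemma grid_sumB (R : realType) (d M : nat) (F G : ('I_d -> R) -> R) :
  grid_sum M (fun x => F x - G x) = grid_sum M F - grid_sum M G.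
Proof. by rewrite /grid_sum sumrB mulrBr. Qed.

Lemma grid_sum_sum (R : realType) (d M : nat) (I : Type) (s : seq I)
    (F : I -> ('I_d -> R) -> R) :
  grid_sum M (fun x => \sum_(i <- s) F i x) = \sum_(i <- s) grid_sum M (F i).
Proof. by rewrite /grid_sum exchange_big/= mulr_sumr. Qed.

(** Fubini on grids: expanding a product of sums gives a sum over all choices of one index per
    coordinate. *)
Lemma grid_sum_prod (R : realType) (d M : nat) (F : 'I_d -> R -> R) :
  grid_sum M (fun x => \prod_n F n (x n)) =
  \prod_n ((M%:R ^+ 2)^-1 * \sum_(k < (2 * M ^ 3)%N) F n (grid_pt R M k)).
Proof.
rewrite /grid_sum big_split/= prodr_const card_ord; congr (_ * _).
by rewrite bigA_distr_bigA.
Qed.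

Lemma cvg_prod (R : realType) (I : Type) (s : seq I) (u : I -> nat -> R) (l : I -> R) :
  (forall i, u i M @[M --> \oo] --> l i) ->
  \prod_(i <- s) u i M @[M --> \oo] --> \prod_(i <- s) l i.
Proof.
move=> ul; elim: s => [|i s IH].
  by under eq_fun do rewrite big_nil; rewrite big_nil; exact: cvg_cst.
by under eq_fun do rewrite big_cons; rewrite big_cons; exact: cvgM.
Qed.

(** Complete the square: [al x^2 + be (z - x)^2] equals [(al + be) (x - be z / (al + be))^2 + al be
    / (al + be) z^2]; then factor over the coordinates. *)
Lemma cvg_grid_gauss (R : realType) : exists2 c : R, 0 < c &
  forall (d : nat) (al be z : 'I_d -> R), (forall n, 0 < al n + be n) ->
    grid_sum M (fun x => expR (- \sum_n (al n * x n ^+ 2 + be n * (z n - x n) ^+ 2)))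
    @[M --> \oo] -->
    \prod_n (c / Num.sqrt (al n + be n)) *
    expR (- \sum_n (al n * be n / (al n + be n) * z n ^+ 2)).
Proof.
have [c c0 cP] := cvg_gauss_sum R.
exists c => // d al be z abP.
have E M : grid_sum M
    (fun x => expR (- \sum_n (al n * x n ^+ 2 + be n * (z n - x n) ^+ 2))) =
    \prod_n gauss_sum M (al n + be n) (be n * z n / (al n + be n)) *
    expR (- \sum_n (al n * be n / (al n + be n) * z n ^+ 2)).
  rewrite mulrC -(grid_sum_prod M (fun n y =>
    expR (- ((al n + be n) * (y - be n * z n / (al n + be n)) ^+ 2)))).
  rewrite -grid_sumZ; congr (grid_sum M _).
  apply/funext => x; rewrite -expR_sum -expRD; congr expR.
  rewrite sumrN -opprD -big_split/=; congr (- _); apply: eq_bigr => n _.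
  by have := abP n => /lt0r_neq0 ?; field.
under eq_fun do rewrite E.
by apply: cvgMr_tmp; apply: cvg_prod => n; exact: cP.
Qed.

(** Count covered pairs with weight [W y] in both orders: if every [y] covered fewer than [p #|A|]
    points, the weighted total would fall short of [p #|A|] times the sum of [W]. *)
Lemma heavy_point (R : realType) (T Y : finType) (cov : T -> Y -> bool)
    (W : Y -> R) (p : R) (A : {set T}) :
  (forall y, 0 <= W y) -> 0 < \sum_y W y ->
  (forall x, x \in A -> p * \sum_y W y <= \sum_(y | cov x y) W y) ->
  exists y, p * #|A|%:R <= #|[set x in A | cov x y]|%:R.
Proof.
move=> W0 Wgt0 H; apply: contrapT => /forallNP nH.
have lt y : #|[set x in A | cov x y]|%:R < p * #|A|%:R.
  by rewrite ltNge; apply/negP => /nH.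
have S : \sum_y W y * #|[set x in A | cov x y]|%:R =
    \sum_(x in A) \sum_(y | cov x y) W y.
  rewrite (exchange_big_dep xpredT)//=; apply: eq_bigr => y _.
  rewrite sumr_const mulr_natr; congr (_ *+ _); apply: eq_card => x.
  by rewrite !inE.
have [y Wy] : exists y, 0 < W y.
  apply: contrapT => /forallNP nW; move: Wgt0; rewrite big1 ?ltxx// => y _.
  by apply/eqP; rewrite eq_le W0 andbT leNgt; apply/negP => /nW.
have : 0 < \sum_y W y * (p * #|A|%:R - #|[set x in A | cov x y]|%:R).
  rewrite (bigD1 y)//= ltr_pwDl ?mulr_gt0 ?subr_gt0//.
  by apply: sumr_ge0 => z _; rewrite mulr_ge0// subr_ge0 ltW.
under eq_bigr do rewrite mulrBr.
rewrite sumrB S -mulr_suml subr_gt0 ltNge => /negP; apply.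
have -> : (\sum_y W y) * (p * #|A|%:R) = \sum_(x in A) (p * \sum_y W y).
  by rewrite sumr_const -[RHS]mulr_natr mulrA [_ * p]mulrC.
by apply: ler_sum => x; exact: H.
Qed.

(** Each new centre is a heavy point for the set still uncovered, which therefore shrinks by the
    factor [1 - p]. *)
Lemma greedy_cover_step (R : realType) (T Y : finType) (cov : T -> Y -> bool)
    (W : Y -> R) (p : R) (A : {set T}) (N : nat) :
  0 <= p <= 1 -> (forall y, 0 <= W y) -> 0 < \sum_y W y ->
  (forall x, x \in A -> p * \sum_y W y <= \sum_(y | cov x y) W y) ->
  exists s : N.-tuple Y,
    #|[set x in A | ~~ has (cov x) s]|%:R <= (1 - p) ^+ N * #|A|%:R.
Proof.
move=> /andP[p0 p1] W0 Wgt0 H; elim: N => [|N [s IH]].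
  exists [tuple]; rewrite mul1r ler_nat subset_leq_card//.
  by apply/fintype.subsetP => x; rewrite inE => /andP[].
set U := [set x in A | _] in IH.
have [|y yP] := @heavy_point R T Y cov W p U W0 Wgt0.
  by move=> x; rewrite inE => /andP[xA _]; exact: H.
exists [tuple of y :: s]; rewrite exprS -mulrA.
apply: le_trans (ler_wpM2l _ IH); last by rewrite subr_ge0.
rewrite mulrBl mul1r lerBrDr.
apply: le_trans (lerD (lexx _) yP) _.
rewrite -natrD ler_nat -[leqRHS](cardsID [set x | cov x y]) addnC.
rewrite leq_add//; apply: subset_leq_card; apply/fintype.subsetP => x.
  by rewrite !inE.
by rewrite !inE /= negb_or => /and3P[-> -> ->].
Qed.

(** As [(1 - p)^N <= exp (- p N)], fewer than one point remains uncovered, hence none. *)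
Lemma greedy_cover (R : realType) (T Y : finType) (cov : T -> Y -> bool)
    (W : Y -> R) (p : R) (A : {set T}) (N : nat) :
  0 <= p <= 1 -> (forall y, 0 <= W y) -> 0 < \sum_y W y ->
  (forall x, x \in A -> p * \sum_y W y <= \sum_(y | cov x y) W y) ->
  ln #|A|%:R < p * N%:R ->
  exists s : N.-tuple Y, forall x, x \in A -> has (cov x) s.
Proof.
move=> p01 W0 Wgt0 H AN.
have [s sP] := greedy_cover_step N p01 W0 Wgt0 H.
exists s => x xA; apply/negPn/negP => nx.
have A0 : 0 < #|A|%:R :> R by rewrite ltr0n; apply/card_gt0P; exists x.
have : 1 <= (1 - p) ^+ N * #|A|%:R.
  apply: le_trans sP; rewrite ler1n; apply/card_gt0P; exists x.
  by rewrite inE xA.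
apply/negP; rewrite -ltNge.
apply: (@le_lt_trans _ _ (expR (- (p * N%:R)) * #|A|%:R)).
  rewrite ler_wpM2r ?ler0n// -mulNr expRM_natr.
  rewrite lerXn2r ?nnegrE ?expR_ge0 ?subr_ge0//; first by case/andP: p01.
  exact: expR_ge1Dx.
by rewrite expRN mulrC ltr_pdivrMr ?expR_gt0// mul1r -[ltLHS]lnK ?posrE// ltr_expR.
Qed.

(** * Coverings in finite dimension: lower bound *)

Lemma cvg_bigsum (R : realType) (I : Type) (s : seq I) (u : I -> nat -> R) (l : I -> R) :
  (forall i, u i M @[M --> \oo] --> l i) ->
  \sum_(i <- s) u i M @[M --> \oo] --> \sum_(i <- s) l i.
Proof.
move=> ul; elim: s => [|i s IH].
  by under eq_fun do rewrite big_nil; rewrite big_nil; exact: cvg_cst.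
by under eq_fun do rewrite big_cons; rewrite big_cons; exact: cvgD.
Qed.

(** Apply [ln (1 + v) <= v] to [(1 + s)^-1 = 1 - s / (1 + s)]. *)
Lemma ln1D_ge (R : realType) (s : R) : 0 <= s -> s - s ^+ 2 <= ln (1 + s).
Proof.
move=> s0; have s1 : 0 < 1 + s by lra.
have : ln (1 + - (s / (1 + s))) <= - (s / (1 + s)).
  by apply: le_ln1Dx; rewrite ltrN2 ltr_pdivrMr// mul1r; lra.
have -> : 1 + - (s / (1 + s)) = (1 + s)^-1 by field; lra.
rewrite lnV ?posrE// lerN2; apply: le_trans.
by rewrite ler_pdivlMr//; have := mulr_ge0 s0 (sqr_ge0 s); rewrite expr2; lra.
Qed.

Lemma lnN1B_le (R : realType) (s : R) : 0 <= s <= 1 / 2 ->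
  - ln (1 - s) <= s + 2 * s ^+ 2.
Proof.
move=> /andP[s0 s12]; have s1 : 0 < 1 - s by lra.
have : ln (1 + s / (1 - s)) <= s / (1 - s).
  by apply: le_ln1Dx; apply: (@lt_le_trans _ _ 0); [lra|rewrite divr_ge0// ltW].
have -> : 1 + s / (1 - s) = (1 - s)^-1 by field; lra.
rewrite lnV ?posrE//; move/le_trans; apply.
rewrite ler_pdivrMr//.
have : 0 <= s ^+ 2 * (1 - 2 * s) by rewrite mulr_ge0 ?sqr_ge0//; lra.
by rewrite expr2; lra.
Qed.

Lemma invsqrt_expR (R : realType) (t : R) : 0 < t ->
  (Num.sqrt t)^-1 = expR (- (ln t / 2)).
Proof.
move=> t0; rewrite expRN; congr (_^-1).
have -> : Num.sqrt t = Num.sqrt (expR (ln t / 2) ^+ 2).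
  by rewrite -expRM_natr divfK ?pnatr_eq0// lnK.
by rewrite sqrtr_sqr ger0_norm ?expR_ge0.
Qed.

(** The Gaussian normalising constant for the precisions [b / m_n^2], with [b] moved into an
    exponent so that changes of [b] compare additively. *)
Lemma prodr_expR_sqrt (R : realType) (c b : R) (d : nat) (m : 'I_d -> R) :
  0 < b -> (forall n, 0 < m n) ->
  \prod_n (c / Num.sqrt (b / m n ^+ 2)) =
  c ^+ d * (\prod_n m n) * expR (- (d%:R / 2 * ln b)).
Proof.
move=> b0 m0.
have E n : c / Num.sqrt (b / m n ^+ 2) = c * m n * expR (- (ln b / 2)).
  rewrite -mulrA; congr (c * _).
  rewrite sqrtrM ?ltW// sqrtrV ?sqr_ge0// sqrtr_sqr gtr0_norm//.
  rewrite invfM invrK mulrC; congr (_ * _).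
  exact: invsqrt_expR.
under eq_bigr do rewrite E.
rewrite 2!big_split/= !prodr_const card_ord -expRM_natr.
by congr (_ * expR _); field.
Qed.

(* Tilting by exp (- Lam) concentrates the mass on {lo <= Lam, D <= hi}; the two
   exponential corrections are Chernoff bounds for the two ways of leaving it. *)
Lemma shell_le_indicator (R : realType) (Lam lo D hi th ga : R) :
  0 <= th -> 0 <= ga ->
  expR (lo - Lam) * (1 - expR (th * (lo - Lam)) - expR (ga * (D - hi)))
  <= (D <= hi)%R%:R.
Proof.
move=> th0 ga0.
have := expR_ge0 (th * (lo - Lam)); have := expR_ge0 (ga * (D - hi)).
have := expR_ge0 (lo - Lam).
move: (expR_ge0 (lo - Lam)).
case: (leP D hi) => [Dhi|hiD] e0 ? ? ? /=; last first.
  rewrite mulr_ge0_le0//.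
  have : 1 <= expR (ga * (D - hi)).
    by rewrite -[leLHS]expR0 ler_expR mulr_ge0// subr_ge0 ltW.
  by lra.
have [loL|Llo] := leP lo Lam.
  apply: (@le_trans _ _ (expR (lo - Lam) * 1)).
    by rewrite ler_wpM2l//; lra.
  by rewrite mulr1 -expR0 ler_expR subr_le0.
apply: (@le_trans _ _ 0); last exact: ler01.
rewrite mulr_ge0_le0//.
have : 1 <= expR (th * (lo - Lam)).
  by rewrite -[leLHS]expR0 ler_expR mulr_ge0// subr_ge0 ltW.
by lra.
Qed.

(** Integrate the pointwise bound [pw]: on the left stands a Gaussian mass restricted to the
    ellipsoid by Chernoff corrections, on the right the mass of [N] Gaussians centred at the [y i].
    The quotient of the two is the product of the [m n / e] up to exp (O(sqrt d)). *)
Lemma finite_dim_covering_lower (R : realType) (d N : nat) (e : R)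
    (m : 'I_d -> R) (y : 'I_N -> 'I_d -> R) :
  (36 <= d)%N -> 0 < e -> (forall n, 0 < m n) ->
  (forall x : 'I_d -> R, \sum_n (x n / m n) ^+ 2 <= 1 ->
    exists i, \sum_n (x n - y i n) ^+ 2 <= e ^+ 2) ->
  \prod_n (m n / e) * expR (- (12 * Num.sqrt d%:R)) / 2 <= N%:R.
Proof.
move=> d36 e0 m0 cov.
have [c c0 cP] := cvg_grid_gauss R.
set D : R := d%:R.
have D36 : 36 <= D by rewrite ler_nat.
set q : R := Num.sqrt D.
have q2 : q ^+ 2 = D by rewrite sqr_sqrtr//; lra.
have q0 : 0 <= q by exact: sqrtr_ge0.
have q6 : 6 <= q by rewrite leNgt; apply/negP => q6; nra.
(* The relative fluctuation of [g] below is of order [1 / sqrt d]; with [d si^2 = 36] both Chernoff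
   factors drop below exp (- 9 / 4), and [36 <= d] gives [si <= 1]. *)
pose si : R := 6 / q.
have si0 : 0 < si by rewrite divr_gt0//; lra.
have si1 : si <= 1 by rewrite ler_pdivrMr; lra.
have siq : si * q = 6 by rewrite /si divfK//; lra.
have siD : D * si = 6 * q by rewrite -siq -q2; ring.
have siD2 : D * si ^+ 2 = 36 by rewrite expr2 mulrA siD mulrAC -mulrA siq; ring.
(* [s] is the relative change of tilt in both Chernoff bounds; under exp (- b g) the mean of [g] is
   [1 / (1 + si)], just inside the ellipsoid; [la] minimises exp (la e^2) la^(- d / 2). *)
pose s : R := si / 4; pose b : R := D / 2 * (1 + si); pose la : R := D / (2 * e ^+ 2).
have b0 : 0 < b by rewrite mulr_gt0//; lra.
have la0 : 0 < la by rewrite divr_gt0 ?mulr_gt0 ?exprn_gt0//; lra.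
pose g (x : 'I_d -> R) := \sum_n (x n / m n) ^+ 2.
(* The typical value of [b g] is [b / (1 + si)], which lies between [lo] and [b]. *)
pose lo := b * (1 - 2 * si).
have pw x : expR lo * expR (- (b * g x)) -
    expR (lo + s * lo) * expR (- ((b + s * b) * g x)) -
    expR (lo - s * b) * expR (- ((b - s * b) * g x)) <=
    expR (la * e ^+ 2) * \sum_i expR (- (la * \sum_n (y i n - x n) ^+ 2)).
  have s0 : 0 <= s by rewrite /s; lra.
  have := @shell_le_indicator R (b * g x) lo (b * g x) b s s s0 s0.
  rewrite mulrBr mulrBr mulr1 -!expRD.
  rewrite -[lo - b * g x + s * _]/(_ + _ * (_ - _)).
  have -> : lo - b * g x + s * (lo - b * g x) =
    lo + s * lo + - ((b + s * b) * g x) by ring.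
  have -> : lo - b * g x + s * (b * g x - b) =
    lo - s * b + - ((b - s * b) * g x) by ring.
  move/le_trans; apply.
  (* [b * g x <= b] says that [x] lies in the ellipsoid; a ball containing [x] then contributes at
     least 1 to the sum on the right. *)
  have [|_] := boolP (b * g x <= b); last first.
    by rewrite mulr_ge0 ?expR_ge0// sumr_ge0// => i _; exact: expR_ge0.
  rewrite -[X in _ <= X]mulr1 ler_pM2l// => /cov[i ile].
  rewrite mulr_sumr (bigD1 i)//= -[leLHS]addr0 lerD//; last first.
    by rewrite sumr_ge0// => j _; rewrite mulr_ge0 ?expR_ge0.
  rewrite -expRD -expR0 ler_expR -mulrBr; apply: mulr_ge0; first exact: ltW.
  rewrite subr_ge0.
  by under eq_bigr do rewrite -sqrrN opprB.
have lim (be : R) : 0 < be -> grid_sum M (fun x => expR (- (be * g x))) @[M --> \oo]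
    --> c ^+ d * (\prod_n m n) * expR (- (D / 2 * ln be)).
  move=> be0; have := cP d (fun n => be / m n ^+ 2) (fun=> 0) (fun=> 0).
  rewrite [X in expR (- X)]big1 ?oppr0 ?expR0 ?mulr1; last first.
    by move=> n _; rewrite expr0n/= mulr0.
  under eq_bigr do rewrite addr0; rewrite prodr_expR_sqrt//.
  have -> : (fun x : 'I_d -> R => expR (- (be * g x))) = (fun x => expR
     (- (\sum_n (be / m n ^+ 2 * x n ^+ 2 + 0 * (0 - x n) ^+ 2)))).
    apply/funext => x; rewrite /g mulr_sumr; congr (expR (- _)).
    by apply: eq_bigr => n _; rewrite mul0r addr0 expr_div_n; ring.
  by apply => n; rewrite addr0 divr_gt0// exprn_gt0.
have limy i : grid_sum M (fun x => expR (- (la * \sum_n (y i n - x n) ^+ 2))) @[M --> \oo]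
    --> c ^+ d * expR (- (D / 2 * ln la)).
  have := cP d (fun n => 0) (fun=> la) (y i).
  rewrite [X in expR (- X)]big1 ?oppr0 ?expR0 ?mulr1; last first.
    by move=> n _; rewrite !mul0r.
  have -> : \prod_(n < d) (c / Num.sqrt (0 + la)) = c ^+ d * expR (- (D / 2 * ln la)).
    have := @prodr_expR_sqrt R c la d (fun=> 1) la0 (fun=> ltr01).
    by rewrite expr1n divr1 add0r [X in _ * X * _]big1// mulr1.
  have -> : (fun x : 'I_d -> R => expR (- (la * \sum_n (y i n - x n) ^+ 2))) =
      (fun x => expR (- (\sum_n (0 * x n ^+ 2 + la * (y i n - x n) ^+ 2)))).
    apply/funext => x; rewrite mulr_sumr; congr (expR (- _)).
    by apply: eq_bigr => n _; rewrite mul0r add0r.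
  by apply => n; rewrite add0r.
have main : expR lo * (c ^+ d * (\prod_n m n) * expR (- (D / 2 * ln b))) -
    expR (lo + s * lo) * (c ^+ d * (\prod_n m n) * expR (- (D / 2 * ln (b + s * b)))) -
    expR (lo - s * b) * (c ^+ d * (\prod_n m n) * expR (- (D / 2 * ln (b - s * b)))) <=
    expR (la * e ^+ 2) * \sum_(i < N) (c ^+ d * expR (- (D / 2 * ln la))).
  have cl : grid_sum M (fun x => expR lo * expR (- (b * g x)) -
      expR (lo + s * lo) * expR (- ((b + s * b) * g x)) -
      expR (lo - s * b) * expR (- ((b - s * b) * g x))) @[M --> \oo] -->
      expR lo * (c ^+ d * (\prod_n m n) * expR (- (D / 2 * ln b))) -
      expR (lo + s * lo) * (c ^+ d * (\prod_n m n) * expR (- (D / 2 * ln (b + s * b)))) -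
      expR (lo - s * b) * (c ^+ d * (\prod_n m n) * expR (- (D / 2 * ln (b - s * b)))).
    under eq_fun do rewrite 2!grid_sumB 3!grid_sumZ.
    by apply: cvgB; [apply: cvgB|]; apply: cvgMl_tmp; apply: lim => //;
      rewrite /s; nra.
  have cr : grid_sum M (fun x =>
      expR (la * e ^+ 2) * \sum_i expR (- (la * \sum_n (y i n - x n) ^+ 2))) @[M --> \oo]
      --> expR (la * e ^+ 2) * \sum_(i < N) (c ^+ d * expR (- (D / 2 * ln la))).
    under eq_fun do rewrite grid_sumZ grid_sum_sum.
    by apply: cvgMl_tmp; apply: cvg_bigsum => i; exact: limy.
  apply: (ler_cvg_to cl cr).
  by apply: nearW => M; apply: ler_grid_sum => x; exact: pw.
have s0 : 0 <= s by rewrite /s; lra.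
have sl : s <= 1 / 2 by rewrite /s; lra.
have D0 : 0 < D by lra.
have lnbp : ln (b + s * b) = ln b + ln (1 + s).
  by rewrite -lnM ?posrE//; [congr ln; ring|lra].
have lnbm : ln (b - s * b) = ln b + ln (1 - s).
  by rewrite -lnM ?posrE//; [congr ln; ring|lra].
have lnb : ln b = ln (D / 2) + ln (1 + si) by rewrite -lnM ?posrE//; lra.
have lnla : ln la = ln (D / 2) - ln e *+ 2.
  have -> : la = (D / 2) / e ^+ 2 by rewrite /la; field; lra.
  by rewrite ln_div ?posrE ?exprn_gt0 ?lnXn//; lra.
(* Square exp (9 / 8) >= 1 + 9 / 8 >= 2. *)
have q9 : expR (- (9 / 4)) <= 1 / 4 :> R.
  rewrite (_ : - (9 / 4) = - (9 / 8) * 2%:R) ?expRM_natr; last by field.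
  rewrite expRN exprVn div1r lef_pV2 ?posrE ?exprn_gt0 ?expR_gt0//.
  by have := expR_ge1Dx (9 / 8 : R); move: (expR _) => z; nra.
have X1 : expR (s * lo - D / 2 * ln (1 + s)) <= 1 / 4.
  apply: le_trans q9; rewrite ler_expR.
  have /(ler_wpM2l (ltW D0)) := ln1D_ge s0.
  have : 0 <= D * (si * si ^+ 2) by do 2?[apply: mulr_ge0; first exact: ltW]; exact: sqr_ge0.
  have -> : s * lo = D * (si / 8) * (1 - si - 2 * si ^+ 2).
    by rewrite /lo /b /s; field.
  have -> : D * (s - s ^+ 2) = D * si / 4 - D * si ^+ 2 / 16 by rewrite /s; field.
  have -> : D * (si / 8) * (1 - si - 2 * si ^+ 2) =
    D * si / 8 - D * si ^+ 2 / 8 - D * (si * si ^+ 2) / 4 by field.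
  by rewrite siD2 [D / 2 * _]mulrAC; lra.
have Y1 : expR (- (s * b) - D / 2 * ln (1 - s)) <= 1 / 4.
  apply: le_trans q9; rewrite ler_expR.
  have := @lnN1B_le R s; rewrite s0 sl => /(_ isT) /(ler_wpM2l (ltW D0)).
  have -> : s * b = D * si / 8 + D * si ^+ 2 / 8 by rewrite /b /s; field.
  have -> : D * (s + 2 * s ^+ 2) = D * si / 4 + D * si ^+ 2 / 8 by rewrite /s; field.
  by rewrite siD2 [D / 2 * _]mulrAC mulrN; lra.
have Pm0 : 0 < \prod_n m n by rewrite prodr_gt0.
have cd0 : 0 < c ^+ d by rewrite exprn_gt0.
have {}main : (\prod_n m n) * expR (lo - D / 2 * ln b) *
    (1 - expR (s * lo - D / 2 * ln (1 + s)) - expR (- (s * b) - D / 2 * ln (1 - s)))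
    <= N%:R * expR (la * e ^+ 2 - D / 2 * ln la).
  rewrite -(ler_pM2l cd0); move: main; rewrite sumr_const card_ord -[_ *+ N]mulr_natl.
  rewrite lnbp lnbm !expRD.
  rewrite (_ : - (D / 2 * (ln b + ln (1 + s))) =
     - (D / 2 * ln b) - D / 2 * ln (1 + s)); last by ring.
  rewrite (_ : - (D / 2 * (ln b + ln (1 - s))) =
     - (D / 2 * ln b) - D / 2 * ln (1 - s)); last by ring.
  rewrite !expRD => main; apply: le_trans (le_trans _ main) _.
    by rewrite le_eqVlt; apply/orP; left; apply/eqP; ring.
  by rewrite le_eqVlt; apply/orP; left; apply/eqP; ring.
have h1 : 1 / 2 <= 1 - expR (s * lo - D / 2 * ln (1 + s)) -
    expR (- (s * b) - D / 2 * ln (1 - s)) by lra.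
have -> : \prod_n (m n / e) = (\prod_n m n) * expR (- (D * ln e)).
  rewrite big_split/= prodr_const card_ord; congr (_ * _).
  by rewrite exprVn expRN [D * _]mulrC expRM_natr lnK.
(* [lo] falls short of [D / 2] by [D si / 2 + D si^2], and [(D / 2) ln (1 + si)] costs at most
   another [D si / 2]; as [si <= 1], the total is at most [2 D si = 12 sqrt d]. *)
have ex : expR (- (D * ln e)) * expR (- (12 * q)) * expR (la * e ^+ 2 - D / 2 * ln la)
    <= expR (lo - D / 2 * ln b).
  rewrite -!expRD ler_expR lnla lnb.
  have -> : la * e ^+ 2 = D / 2 by rewrite /la; field; rewrite gt_eqF.
  have /(ler_wpM2l (ltW D0)) : ln (1 + si) <= si by apply: le_ln1Dx; lra.
  have -> : lo = D / 2 - D * si / 2 - D * si ^+ 2 by rewrite /lo /b; field.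
  have -> : 12 * q = D * si * 2 by rewrite siD; ring.
  have : D * si ^+ 2 <= D * si by rewrite ler_pM2l// expr2 ler_piMr// ltW.
  by lra.
rewrite -(ler_pM2r (expR_gt0 (la * e ^+ 2 - D / 2 * ln la))).
apply: le_trans main; apply: le_trans (ler_wpM2l _ h1); last first.
  by rewrite mulr_ge0 ?expR_ge0// ltW.
by have := ler_wpM2l (ltW Pm0) ex; lra.
Qed.

(** * Coverings in finite dimension: upper bound *)

Section coordinate.
Variables (R : realType) (e m w z th ga : R).
Hypotheses (e0 : 0 < e) (em : e < m) (w0 : 0 < w).
(** The weight exp (- al y^2) is a Gaussian of variance [w (m^2 - e^2)], and [la] multiplies
    [(z - y)^2] in the tilt. [A] is half the energy of the target [z] relative to [w]. *)
Let al := (2 * w * (m ^+ 2 - e ^+ 2))^-1.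
Let la := (2 * e ^+ 2 * w)^-1.
Let r := (e / m) ^+ 2.
Let A := (z / m) ^+ 2 / w / 2.

Let m0 : 0 < m. Proof. exact: lt_trans em. Qed.
Let me0 : 0 < m ^+ 2 - e ^+ 2.
Proof. by rewrite subr_gt0 ltr_pXn2r// nnegrE ltW. Qed.
Let al0 : 0 < al. Proof. by rewrite invr_gt0 !mulr_gt0. Qed.
Let la0 : 0 < la. Proof. by rewrite invr_gt0 !mulr_gt0// exprn_gt0. Qed.
Let neqs : [/\ e != 0, m != 0, w != 0 & m ^+ 2 - e ^+ 2 != 0].
Proof. by split; exact: lt0r_neq0. Qed.

Let regroup_le (c s E1 E2 E3 E4 : R) : 0 <= c -> 0 <= s ->
  E1 * E2 <= E3 * E4 -> c * (s * E1) * E2 <= c * s * E3 * E4.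
Proof.
move=> c0 s0 E; rewrite mulrA -[leLHS]mulrA -[leRHS]mulrA.
by apply: ler_wpM2l => //; exact: mulr_ge0.
Qed.

Lemma coord_r01 : 0 < r < 1.
Proof.
rewrite exprn_gt0 ?divr_gt0//= /r expr_div_n ltr_pdivrMr ?exprn_gt0// mul1r.
by rewrite -subr_gt0.
Qed.

Let alla : al + la = al / r.
Proof.
have [? ? ? ?] := neqs.
by rewrite /al /la /r; field; do ?[apply/andP; split].
Qed.

(** Because [al + la = al / r], the tilt multiplies the normalising constant by [e / m], whatever
    [w] is, and [al la / (al + la)] becomes [1 / (2 w m^2)]. *)
Lemma coord_tilt0 (c : R) :
  c / Num.sqrt (al + la) * expR (- (al * la / (al + la) * z ^+ 2)) =
  c / Num.sqrt al * (e / m) * expR (- A).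
Proof.
have [? ? ? ?] := neqs; have /andP[r0 _] := coord_r01.
congr (_ * expR (- _)).
  rewrite alla sqrtrM ?ltW// [Num.sqrt r^-1]sqrtrV ?ltW// /r sqrtr_sqr ger0_norm ?divr_ge0 ?ltW//.
  rewrite [(_ / (e / m))^-1]invf_div. by rewrite [e / m / _]mulrC [LHS]mulrA.
rewrite alla /al /la /r /A; field; do ?[apply/andP; split] => //.
Qed.

(** Second-order expansion in [th]: under the tilted law [y] has variance [w e^2 (1 - r)] and
    [z - y] has mean [r z], so [la (z - y)^2] has mean [(1 - r) / 2 + r A]. *)
Lemma coord_tilt_up (c : R) : 0 <= c -> 0 <= th ->
  c / Num.sqrt (al + (1 + th) * la) *
    expR (- (al * ((1 + th) * la) / (al + (1 + th) * la) * z ^+ 2)) <=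
  c / Num.sqrt (al + la) * expR (- (al * la / (al + la) * z ^+ 2)) *
    expR (- (th * ((1 - r) / 2 + r * A)) + th ^+ 2 * (1 / 2 + A)).
Proof.
move=> c0 th0.
have [? ? ? ?] := neqs; have /andP[r0 r1] := coord_r01.
have A0 : 0 <= A by rewrite !divr_ge0 ?sqr_ge0 ?ltW.
pose q := 1 - r; have q0 : 0 < q by rewrite subr_gt0.
have q1 : q <= 1 by rewrite /q; lra.
have thq : 0 < 1 + th * q by rewrite ltr_pwDl// mulr_ge0// ltW.
have E : al + (1 + th) * la = (al + la) * (1 + th * q).
  by rewrite /q /al /la /r; field; do ?[apply/andP; split].
have all0 : 0 < al + la by rewrite addr_gt0.
have -> : al * ((1 + th) * la) / (al + (1 + th) * la) * z ^+ 2 =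
    al * la / (al + la) * z ^+ 2 * ((1 + th) / (1 + th * q)).
  by rewrite E; field; rewrite !gt_eqF.
have Aeq : al * la / (al + la) * z ^+ 2 = A.
  by rewrite alla /al /la /r /A; field; do ?[apply/andP; split].
rewrite Aeq E (sqrtrM _ (ltW all0)) invfM (invsqrt_expR thq).
apply: regroup_le => //.
rewrite -!expRD ler_expR.
have h1 : th * q - th ^+ 2 <= ln (1 + th * q).
  apply: le_trans (ln1D_ge _); last by rewrite mulr_ge0// ltW.
  by rewrite lerD2l lerN2 exprMn ler_piMr ?sqr_ge0// expr_le1// ltW.
have h2 : A * (1 + th * r - th ^+ 2) <= A * ((1 + th) / (1 + th * q)).
  rewrite ler_wpM2l// ler_pdivlMr//.
  have e1 : 0 <= th ^+ 2 * (1 - r * q) by rewrite mulr_ge0 ?sqr_ge0// subr_ge0 mulr_ile1// ltW.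
  have e2 : 0 <= th ^+ 3 * q by rewrite mulr_ge0 ?exprn_ge0// ltW.
  have -> : (1 + th * r - th ^+ 2) * (1 + th * q) =
      1 + th * (r + q) - th ^+ 2 * (1 - r * q) - th ^+ 3 * q by ring.
  have -> : r + q = 1 by rewrite /q; ring.
  by rewrite mulr1; lra.
by rewrite -/q; lra.
Qed.

(** The first-order term is [ga] times the tilted mean of [(z - y)^2], that is
    [e^2 (w (1 - r) + r (z / m)^2)]; the factor [1 + 8 ga e^2] absorbs the higher orders. The two
    upper bounds keep [t] below 1 / 2, where [lnN1B_le] applies. *)
Lemma coord_tilt_down (c : R) : 0 <= c -> 0 <= ga -> w <= 2 -> ga * e ^+ 2 <= 1 / 8 ->
  c / Num.sqrt (al + (la - ga)) *
    expR (- (al * (la - ga) / (al + (la - ga)) * z ^+ 2)) <=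
  c / Num.sqrt (al + la) * expR (- (al * la / (al + la) * z ^+ 2)) *
    expR (ga * e ^+ 2 * (1 + 8 * (ga * e ^+ 2)) * (w * (1 - r) + r * (z / m) ^+ 2)).
Proof.
move=> c0 ga0 w2 g8.
have [? ? ? ?] := neqs; have /andP[r0 r1] := coord_r01.
pose q := 1 - r; have q0 : 0 < q by rewrite subr_gt0.
have q1 : q <= 1 by rewrite /q; lra.
pose v := w * q * e ^+ 2; pose t := 2 * (ga * v).
have e20 : 0 < e ^+ 2 by rewrite exprn_gt0.
have v0 : 0 < v by rewrite !mulr_gt0.
have t0 : 0 <= t by rewrite !mulr_ge0// ltW.
have t4 : t <= 4 * (ga * e ^+ 2).
  have -> : t = 2 * (w * q) * (ga * e ^+ 2) by rewrite /t /v; ring.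
  apply: ler_wpM2r; first by apply: mulr_ge0 => //; exact: ltW.
  have : w * q <= 2 * 1 by rewrite ler_pM// ltW.
  by lra.
have t1 : 0 < 1 - t by lra.
have E : al + (la - ga) = (al + la) * (1 - t).
  by rewrite /t /v /q /al /la /r; field; do ?[apply/andP; split].
have all0 : 0 < al + la by rewrite addr_gt0.
pose u := e ^+ 2 * (r * (z / m) ^+ 2).
have u0 : 0 <= u.
  by do 2?[apply: mulr_ge0; first exact: ltW]; exact: sqr_ge0.
have Aeq : al * la / (al + la) * z ^+ 2 = A.
  by rewrite alla /al /la /r /A; field; do ?[apply/andP; split].
have -> : al * (la - ga) / (al + (la - ga)) * z ^+ 2 = A - ga * u / (1 - t).
  have t1' := lt0r_neq0 t1; have all0' := lt0r_neq0 all0.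
  have k1 : al * la * z ^+ 2 = (al + la) * A by rewrite -Aeq; field.
  have k2 : al * (ga * z ^+ 2) = (al + la) * (A * t + ga * u).
    have -> : A * t + ga * u = ga * (r * z ^+ 2).
      by rewrite /A /t /u /v /q /r; field; do ?[apply/andP; split].
    by rewrite alla; field; rewrite gt_eqF.
  have k3 : al * (la - ga) * z ^+ 2 = (al + la) * (A * (1 - t) - ga * u) by lra.
  by rewrite E mulrAC k3; field; rewrite all0' t1'.
rewrite Aeq E (sqrtrM _ (ltW all0)) invfM (invsqrt_expR t1).
apply: regroup_le => //.
rewrite -!expRD ler_expR.
have h1 : - ln (1 - t) <= t + 2 * t ^+ 2 by apply: lnN1B_le; lra.
have h2 : ga * u / (1 - t) <= ga * u * (1 + 2 * t).
  apply: ler_wpM2l; first exact: mulr_ge0.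
  rewrite -div1r ler_pdivrMr//.
  have : 0 <= t * (1 - 2 * t) by rewrite mulr_ge0//; lra.
  by lra.
have h3 : t * t <= t * (4 * (ga * e ^+ 2)) by rewrite ler_wpM2l.
have h4 : (ga * u) * t <= (ga * u) * (4 * (ga * e ^+ 2)).
  by apply: ler_wpM2l => //; exact: mulr_ge0.
have -> : ga * e ^+ 2 * (1 + 8 * (ga * e ^+ 2)) * (w * (1 - r) + r * (z / m) ^+ 2)
   = t / 2 + ga * u + 4 * (t * (ga * e ^+ 2)) + 8 * (ga * u * (ga * e ^+ 2)).
  by rewrite /t /u /v /q; field.
lra.
Qed.

End coordinate.

(* What the probability of covering a given point may lose against the product
   of the [e / m n]. *)
Definition slack_factor (R : realType) (d J : nat) : R :=
  expR (- (d%:R / J%:R / 2) - (1 + ln (36 * J%:R ^+ 4)) * Num.sqrt d%:R)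
  / (24 * J%:R ^+ 4).

(** The first-order terms of the two coordinate lemmas add up to the tilted means of
    [\sum la (z - y)^2] and of the squared distance. The first two inequalities on sums keep the
    former from being too small and the latter from being too large, so that [shell_le_indicator]
    applies with little loss. *)
Lemma grid_cover_prob (R : realType) (d J : nat) (e : R) (m w z : 'I_d -> R) :
  (0 < d)%N -> (0 < J)%N -> 0 < e -> (forall n, e < m n) ->
  (forall n, 0 < w n) -> (forall n, w n <= 2) ->
  - (d%:R / J%:R) <= \sum_n (1 - (e / m n) ^+ 2) * (1 - (z n / m n) ^+ 2 / w n) ->
  \sum_n (e / m n) ^+ 2 * ((z n / m n) ^+ 2 - w n) <= (\sum_n w n) / J%:R ->
  \sum_n (z n / m n) ^+ 2 / w n <= d%:R ->
  1 / J%:R ^+ 2 <= \sum_n w n ->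
  let W (y : 'I_d -> R) :=
    expR (- \sum_n ((2 * w n * (m n ^+ 2 - e ^+ 2))^-1 * y n ^+ 2)) in
  \forall M \near \oo, 0 < grid_sum M W /\
    (\prod_n (e / m n)) * slack_factor R d J * grid_sum M W <=
    grid_sum M (fun y => W y *
      (\sum_n (z n - y n) ^+ 2 <= e ^+ 2 * (1 + J%:R^-1) ^+ 3 * \sum_n w n)%R%:R).
Proof.
move=> d0 J0 e0 em w0 w2 h1 h2 h3 h4 W.
have [c c0 cP] := cvg_grid_gauss R.
set K : R := J%:R; set Sw := \sum_n w n.
have K0 : 0 < K by rewrite ltr0n.
have K1 : 1 <= K by rewrite ler1n.
pose al n := (2 * w n * (m n ^+ 2 - e ^+ 2))^-1.
pose la n := (2 * e ^+ 2 * w n)^-1.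
pose A n := (z n / m n) ^+ 2 / w n / 2.
pose q : R := Num.sqrt d%:R; pose th := q^-1.
have q0 : 0 < q by rewrite sqrtr_gt0 ltr0n.
have q2 : q ^+ 2 = d%:R by rewrite sqr_sqrtr.
have th0 : 0 <= th by rewrite invr_ge0 ltW.
(* As [8 g = 1 / K], one factor [1 + 1 / K] of [hi] pays for the higher orders in [coord_tilt_down]
   and one for the mean; the third leaves a Chernoff gap of at least [1 / (8 K^4)]. *)
pose g := (8 * K)^-1; pose ga := g / e ^+ 2.
have g0 : 0 < g by rewrite invr_gt0 mulr_gt0.
have g8 : g <= 1 / 8.
  by rewrite /g div1r lef_pV2 ?posrE ?mulr_gt0//; lra.
have gae : ga * e ^+ 2 = g by rewrite divfK// gt_eqF// exprn_gt0.
have ga0 : 0 <= ga by rewrite divr_ge0 ?sqr_ge0// ltW.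
(* Multiplied by [th = 1 / q], the margin [(1 + ka) q] in [lo] becomes [1 + ka]: the 1 pays for
   [th^2 d = 1], the rest makes the loss exp (- ka). *)
pose ka := ln (36 * K ^+ 4).
pose lo := \sum_n A n - d%:R / K / 2 - (1 + ka) * q.
pose hi := e ^+ 2 * (1 + K^-1) ^+ 3 * Sw.
have al0 n : 0 < al n.
  rewrite invr_gt0 !mulr_gt0// subr_gt0 ltr_pXn2r// nnegrE ltW//.
  exact: lt_trans (em n).
have la0 n : 0 < la n by rewrite invr_gt0 !mulr_gt0// exprn_gt0.
have W_gt0 y : 0 < W y by exact: expR_gt0.
pose E (be : 'I_d -> R) (y : 'I_d -> R) :=
  expR (- \sum_n (al n * y n ^+ 2 + be n * (z n - y n) ^+ 2)).
pose L (be : 'I_d -> R) := \prod_n (c / Num.sqrt (al n + be n) *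
    expR (- (al n * be n / (al n + be n) * z n ^+ 2))).
have cE be : (forall n, 0 < al n + be n) ->
    grid_sum M (E be) @[M --> \oo] --> L be.
  move=> /(cP d al be z); rewrite -sumrN expR_sum.
  by rewrite -[_ * \prod_n expR _]big_split.
have pw y : expR lo * E la y - expR (lo + th * lo) * E (fun n => (1 + th) * la n) y
    - expR (lo - ga * hi) * E (fun n => la n - ga) y <=
    W y * (\sum_n (z n - y n) ^+ 2 <= hi)%R%:R.
  have := @shell_le_indicator R (\sum_n la n * (z n - y n) ^+ 2) lo
    (\sum_n (z n - y n) ^+ 2) hi th ga th0 ga0.
  move=> /(ler_wpM2l (ltW (W_gt0 y))); apply: le_trans.
  rewrite le_eqVlt; apply/orP; left; apply/eqP.
  have Ela : E la y = W y * expR (- \sum_n la n * (z n - y n) ^+ 2).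
    by rewrite /E /W -expRD -opprD -big_split.
  have Eup : E (fun n => (1 + th) * la n) y =
    E la y * expR (- (th * \sum_n la n * (z n - y n) ^+ 2)).
    rewrite /E -expRD -opprD; congr (expR (- _)).
    by rewrite mulr_sumr -big_split/=; apply: eq_bigr => n _; ring.
  have Edn : E (fun n => la n - ga) y = E la y * expR (ga * \sum_n (z n - y n) ^+ 2).
    rewrite /E -expRD; congr expR; rewrite -[_ * \sum_n _]opprK -opprD.
    congr (- _); rewrite mulr_sumr -sumrN -big_split/=.
    by apply: eq_bigr => n _; ring.
  rewrite Eup Edn Ela; move: (\sum_n la n * (z n - y n) ^+ 2) (\sum_n (z n - y n) ^+ 2) => La D.
  by rewrite [th * (lo - La)]mulrBr [ga * (D - hi)]mulrBr !expRD; ring.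
have r01 n : 0 < (e / m n) ^+ 2 < 1 by exact: coord_r01.
have alla0 n : 0 < al n + la n by exact: addr_gt0.
have L0 : L la = L (fun=> 0) * (\prod_n (e / m n)) * expR (- \sum_n A n).
  rewrite -sumrN expR_sum -!big_split/=; apply: eq_bigr => n _.
  rewrite (coord_tilt0 (z n) e0 (em n) (w0 n)).
  by rewrite addr0 mulr0 !mul0r oppr0 expR0 mulr1.
have Lge0 n : 0 <= c / Num.sqrt (al n + la n) *
    expR (- (al n * la n / (al n + la n) * z n ^+ 2)).
  by rewrite mulr_ge0 ?expR_ge0// divr_ge0// ltW.
(* The linear term uses [(1 - r) / 2 + r A = A + (1 - r) (1 - 2 A) / 2]; the quadratic one uses that
   [A] sums to at most [d / 2]. *)
have L1 : L (fun n => (1 + th) * la n) <=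
    L la * expR (- (th * (\sum_n A n - d%:R / K / 2)) + th ^+ 2 * d%:R).
  apply: (@le_trans _ _ (L la * expR (\sum_n
     (- (th * ((1 - (e / m n) ^+ 2) / 2 + (e / m n) ^+ 2 * A n)) + th ^+ 2 * (1 / 2 + A n))))).
    rewrite expR_sum -big_split/=; apply: ler_prod => n _.
    rewrite mulr_ge0 ?expR_ge0 ?divr_ge0 ?sqrtr_ge0 ?(ltW c0)//=.
    by apply: coord_tilt_up => //; exact: ltW.
  rewrite ler_wpM2l ?prodr_ge0// ler_expR big_split/= sumrN -!mulr_sumr.
  have -> : \sum_n (1 / 2 + A n) = d%:R / 2 + \sum_n A n.
    by rewrite big_split/= sumr_const card_ord -[_ *+ d]mulr_natr div1r mulrC.
  have -> : \sum_n ((1 - (e / m n) ^+ 2) / 2 + (e / m n) ^+ 2 * A n) = \sum_n A n +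
      (\sum_n (1 - (e / m n) ^+ 2) * (1 - (z n / m n) ^+ 2 / w n)) / 2.
    rewrite mulr_suml -big_split/=; apply: eq_bigr => n _; rewrite /A; field.
    by rewrite !gt_eqF// (lt_trans e0).
  have A2 : \sum_n A n <= d%:R / 2 by rewrite -mulr_suml ler_pM2r.
  rewrite lerD//; last by rewrite ler_wpM2l ?sqr_ge0//; lra.
  by rewrite lerN2 ler_wpM2l//; lra.
have dn0 n : 0 < al n + (la n - ga).
  rewrite addr_gt0// subr_gt0 -(ltr_pM2r (_ : 0 < e ^+ 2)) ?exprn_gt0// gae.
  apply: le_lt_trans g8 _.
  have -> : la n * e ^+ 2 = (2 * w n)^-1 by rewrite /la; field; rewrite !gt_eqF.
  by rewrite div1r ltf_pV2 ?posrE ?mulr_gt0//; have := w2 n; lra.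
have L2 : L (fun n => la n - ga) <=
    L la * expR (g * (1 + 8 * g) * ((1 + K^-1) * Sw)).
  apply: (@le_trans _ _ (L la * expR (\sum_n
     (g * (1 + 8 * g) * (w n * (1 - (e / m n) ^+ 2) + (e / m n) ^+ 2 * (z n / m n) ^+ 2))))).
    rewrite expR_sum -big_split/=; apply: ler_prod => n _.
    rewrite mulr_ge0 ?expR_ge0 ?divr_ge0 ?sqrtr_ge0 ?(ltW c0)//=.
    rewrite -gae; apply: coord_tilt_down => //; rewrite ?gae//; exact: ltW.
  rewrite ler_wpM2l ?prodr_ge0// ler_expR -mulr_sumr.
  apply: ler_wpM2l; first by rewrite mulr_ge0 ?addr_ge0 ?mulr_ge0// ltW.
  have -> : \sum_n (w n * (1 - (e / m n) ^+ 2) + (e / m n) ^+ 2 * (z n / m n) ^+ 2) =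
      Sw + \sum_n (e / m n) ^+ 2 * ((z n / m n) ^+ 2 - w n).
    by rewrite -big_split/=; apply: eq_bigr => n _; ring.
  by rewrite mulrDl mul1r lerD2l mulrC.
have LW0 : 0 < L (fun=> 0).
  by apply: prodr_gt0 => n _; rewrite mulr_gt0 ?expR_gt0// divr_gt0// sqrtr_gt0 addr0.
have Lla0 : 0 <= L la by apply: prodr_ge0.
(* The losses [1 / (36 K^4)] and [1 - 1 / (9 K^4)] leave [1 / (12 K^4)], twice the constant of
   [slack_factor]; the factor 2 is the strict gap that carries the limit back to finite grids. *)
have lim_ge : 2 * ((\prod_n (e / m n)) * slack_factor R d J * L (fun=> 0)) <=
    expR lo * L la - expR (lo + th * lo) * L (fun n => (1 + th) * la n)
    - expR (lo - ga * hi) * L (fun n => la n - ga).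
  have K30 : 0 < K ^+ 4 by rewrite exprn_gt0.
  have K31 : 1 <= K ^+ 4 by rewrite exprn_ege1.
  have thq : th * q = 1 by rewrite mulVf ?gt_eqF.
  have th2d : th ^+ 2 * d%:R = 1 by rewrite -q2 -exprMn thq expr1n.
  have B0 : 0 <= expR lo * L la by rewrite mulr_ge0 ?expR_ge0.
  have X1 : expR (lo + th * lo) * L (fun n => (1 + th) * la n) <=
      expR lo * L la * (36 * K ^+ 4)^-1.
    apply: le_trans (ler_wpM2l (expR_ge0 _) L1) _.
    rewrite mulrCA -expRD [expR lo * _]mulrC -[leRHS]mulrA; apply: ler_wpM2l => //.
    have -> : (36 * K ^+ 4)^-1 = expR (- ka).
      by rewrite expRN lnK// posrE mulr_gt0.
    rewrite -expRD ler_expR th2d.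
    have : th * lo = th * (\sum_n A n - d%:R / K / 2) - (1 + ka) * (th * q).
      by rewrite /lo; ring.
    by rewrite thq; lra.
  have X2 : expR (lo - ga * hi) * L (fun n => la n - ga) <=
      expR lo * L la * (1 - (9 * K ^+ 4)^-1).
    apply: le_trans (ler_wpM2l (expR_ge0 _) L2) _.
    rewrite mulrCA -expRD [expR lo * _]mulrC -[leRHS]mulrA; apply: ler_wpM2l => //.
    rewrite -addrA expRD; apply: ler_wpM2l; first exact: expR_ge0.
    apply: (@le_trans _ _ (expR (- (8 * K ^+ 4)^-1))).
      rewrite ler_expR.
      have -> : ga * hi = g * (1 + K^-1) ^+ 3 * Sw by rewrite /hi -gae; ring.
      have -> : 8 * g = K^-1 by rewrite /g; field; rewrite gt_eqF.
      have -> : - (g * (1 + K^-1) ^+ 3 * Sw) + g * (1 + K^-1) * ((1 + K^-1) * Sw) =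
        - (g * K^-1 * ((1 + K^-1) ^+ 2 * Sw)) by ring.
      have -> : (8 * K ^+ 4)^-1 = g * K^-1 * (1 / K ^+ 2).
        by rewrite /g; field; rewrite gt_eqF.
      rewrite lerN2; apply: ler_wpM2l; first by apply: divr_ge0; exact: ltW.
      apply: le_trans h4 _; rewrite -[leLHS]mul1r; apply: ler_wpM2r.
        by apply: sumr_ge0 => n _; exact: ltW.
      by apply: exprn_ege1; rewrite lerDl invr_ge0 ltW.
    rewrite expRN.
    apply: (@le_trans _ _ ((1 + (8 * K ^+ 4)^-1)^-1)).
      by rewrite lef_pV2 ?posrE ?expR_gt0 ?addr_gt0 ?invr_gt0 ?mulr_gt0// expR_ge1Dx.
    rewrite -div1r ler_pdivrMr ?addr_gt0 ?invr_gt0 ?mulr_gt0//.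
    move: K31; set k := K ^+ 4 => k1.
    rewrite -subr_ge0.
    have -> : (1 - (9 * k)^-1) * (1 + (8 * k)^-1) - 1 = (k - 1) / (72 * k ^+ 2).
      by field; rewrite gt_eqF.
    by rewrite divr_ge0 ?subr_ge0// mulr_ge0 ?sqr_ge0.
  have -> : 2 * ((\prod_n (e / m n)) * slack_factor R d J * L (fun=> 0)) =
      expR lo * L la * (12 * K ^+ 4)^-1.
    rewrite L0 /slack_factor -/K -/ka -/q.
    set t := - (d%:R / K / 2) - (1 + ka) * q.
    have -> : lo = t + \sum_n A n by rewrite /lo /t; ring.
    rewrite (expRD t) [expR (- \sum_n A n)]expRN.
    have := gt_eqF (expR_gt0 (\sum_n A n)).
    move: (expR (\sum_n A n)) => x xN0.
    by field; rewrite gt_eqF//= xN0.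
  have : expR lo * L la * (12 * K ^+ 4)^-1 =
     expR lo * L la - expR lo * L la * (36 * K ^+ 4)^-1 -
     expR lo * L la * (1 - (9 * K ^+ 4)^-1) by field; rewrite gt_eqF.
  by move=> ->; rewrite lerB// lerB.
have cW : grid_sum M W @[M --> \oo] --> L (fun=> 0).
  have -> : W = E (fun=> 0).
    apply/funext => y; congr (expR (- _)); apply: eq_bigr => n _.
    by rewrite mul0r addr0.
  by apply: cE => n; rewrite addr0.
have cpw : grid_sum M (fun y => expR lo * E la y
    - expR (lo + th * lo) * E (fun n => (1 + th) * la n) y
    - expR (lo - ga * hi) * E (fun n => la n - ga) y) @[M --> \oo] -->
    expR lo * L la - expR (lo + th * lo) * L (fun n => (1 + th) * la n)
    - expR (lo - ga * hi) * L (fun n => la n - ga).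
  under eq_fun do rewrite 2!grid_sumB 3!grid_sumZ.
  apply: cvgB; [apply: cvgB|]; apply: cvgMl_tmp; apply: cE => n.
  - exact: alla0.
  - by rewrite addr_gt0// mulr_gt0// ltr_pwDl.
  - exact: dn0.
have p0 : 0 < (\prod_n (e / m n)) * slack_factor R d J * L (fun=> 0).
  have sf0 : 0 < slack_factor R d J.
    by rewrite divr_gt0 ?expR_gt0// mulr_gt0// exprn_gt0.
  do 2?[apply: mulr_gt0 => //].
  by apply: prodr_gt0 => n _; rewrite divr_gt0// (lt_trans e0).
near=> M; split.
  by near: M; exact: (cvgr_gt _ cW).
apply: le_trans (ler_grid_sum M pw).
rewrite -subr_ge0; apply: ltW; near: M.
apply: (cvgr_gt _ (cvgB cpw (cvgMl_tmp cW))).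
rewrite subr_gt0; apply: lt_le_trans lim_ge.
by rewrite mulr_natl mulr2n ltrDl.
Unshelve. all: by end_near. Qed.

(** * Sharing an energy profile among the coordinates *)

Section block_weights.
Variables (R : realType) (d J : nat) (b : 'I_d -> 'I_J) (T : 'I_J -> R)
  (xi r : 'I_d -> R).
Hypotheses (d0 : (0 < d)%N) (J0 : (0 < J)%N) (T0 : forall j, 0 < T j)
  (xi0 : forall n, 0 <= xi n) (xiT : forall j, \sum_(n | b n == j) xi n <= T j)
  (r1 : forall n, r n <= 1)
  (rb : forall n, (b n)%:R / J%:R <= r n <= ((b n).+1)%:R / J%:R).

Let cnt j := #|[pred n | b n == j]|.

(** [T j] is the energy budget of block [j], here shared equally; [xi] is the energy of the point to
    cover and [r n] stands for [(e / m n)^2]. *)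
Definition block_weight n : R := T (b n) / (cnt (b n))%:R.

Let cnt_gt0 n : 0 < (cnt (b n))%:R :> R.
Proof. by rewrite ltr0n; apply/card_gt0P; exists n; rewrite inE. Qed.

Lemma block_weight_gt0 n : 0 < block_weight n.
Proof. by rewrite divr_gt0. Qed.

Lemma block_weight_le n : block_weight n <= T (b n).
Proof.
rewrite ler_pdivrMr// ler_peMr ?(ltW (T0 _))//.
by rewrite ler1n; apply/card_gt0P; exists n; rewrite inE.
Qed.

(** The witness [n0] excludes empty blocks, whose weights sum to 0 instead of [T j]. *)
Let sum_block j n0 : b n0 = j -> \sum_(n | b n == j) block_weight n = T j.
Proof.
move=> bj; rewrite (eq_bigr (fun=> T j / (cnt j)%:R)); last first.
  by move=> n /eqP bn; rewrite /block_weight bn.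
by rewrite sumr_const -[_ *+ _]mulr_natr divfK// gt_eqF// -bj.
Qed.

Let sum_block_le j : \sum_(n | b n == j) block_weight n <= T j.
Proof.
have [[n0 /sum_block->//]|/forallNP nb] := pselect (exists n0, b n0 = j).
by rewrite big_pred0 ?ltW// => n; apply/negP => /eqP /nb.
Qed.

Lemma sum_block_weight_le : \sum_n block_weight n <= \sum_j T j.
Proof. by rewrite (partition_big b xpredT)//=; apply: ler_sum. Qed.

Lemma sum_block_weight_ge (t : R) : (forall j, t <= T j) ->
  t <= \sum_n block_weight n.
Proof.
move=> tT; pose n0 := Ordinal d0.
apply: (le_trans (tT (b n0))); rewrite -(sum_block erefl) [leRHS](bigID [pred n | b n == b n0])/=.
by rewrite lerDl sumr_ge0// => n _; rewrite ltW// block_weight_gt0.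
Qed.

Let sum_xi_le (c : 'I_J -> R) : (forall j, 0 <= c j) ->
  \sum_n c (b n) * xi n <= \sum_n c (b n) * block_weight n.
Proof.
move=> c0; rewrite [leLHS](partition_big b xpredT)// [leRHS](partition_big b xpredT)//=.
apply: ler_sum => j _.
have E (F : 'I_d -> R) : \sum_(n | b n == j) c (b n) * F n =
    c j * \sum_(n | b n == j) F n.
  by rewrite mulr_sumr; apply: eq_bigr => n /eqP ->.
rewrite !E ler_wpM2l//.
have [[n0 /sum_block->//]|/forallNP nb] := pselect (exists n0, b n0 = j).
by rewrite !big_pred0// => n; apply/negP => /eqP /nb.
Qed.

Let sum_ratio_le (c : 'I_J -> R) : (forall j, 0 <= c j) ->
  \sum_n c (b n) * (xi n / block_weight n) <= \sum_n c (b n).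
Proof.
move=> c0.
(* This coefficient is [c] divided by the weight, which is constant on each block. *)
have := @sum_xi_le (fun j => c j * (cnt j)%:R / T j).
have -> : \sum_n c (b n) * (cnt (b n))%:R / T (b n) * xi n =
    \sum_n c (b n) * (xi n / block_weight n).
  apply: eq_bigr => n _; rewrite /block_weight; field.
  by rewrite !gt_eqF.
have -> : \sum_n c (b n) * (cnt (b n))%:R / T (b n) * block_weight n =
    \sum_n c (b n).
  apply: eq_bigr => n _; rewrite /block_weight; field.
  by rewrite !gt_eqF.
by apply => j; rewrite divr_ge0 ?mulr_ge0// ltW.
Qed.

Lemma block_weight_ratio : \sum_n xi n / block_weight n <= d%:R.
Proof.
have := @sum_ratio_le (fun=> 1) (fun=> ler01).
by under eq_bigr do rewrite mul1r; rewrite sumr_const card_ord.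
Qed.

Let J0' : 0 < J%:R :> R. Proof. by rewrite ltr0n. Qed.

(** With [1 - r n] replaced by its upper bound [1 - j / J] on block [j], coefficients are constant
    on blocks and the sum is nonnegative; the replacement costs at most [1 / J] per coordinate. *)
Lemma block_weight_tilt_up :
  - (d%:R / J%:R) <= \sum_n (1 - r n) * (1 - xi n / block_weight n).
Proof.
pose rho (j : 'I_J) : R := 1 - j%:R / J%:R.
have rho0 j : 0 <= rho j.
  by rewrite subr_ge0 ler_pdivrMr// mul1r ler_nat ltnW.
have := sum_ratio_le rho0; rewrite -subr_ge0 -sumrB => h.
apply: (@le_trans _ _ (\sum_n (rho (b n) - rho (b n) * (xi n / block_weight n) - 1 / J%:R))).
  rewrite sumrB sumr_const card_ord -[(1 / J%:R) *+ d]mulr_natl mul1r.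
  by rewrite -[leLHS]add0r lerD2r.
apply: ler_sum => n _.
have x0 : 0 <= xi n / block_weight n by rewrite divr_ge0// ltW// block_weight_gt0.
have /andP[rl ru] := rb n.
have h1 : (1 - r n) * (xi n / block_weight n) <= rho (b n) * (xi n / block_weight n).
  by rewrite ler_wpM2r// /rho lerB.
have h2 : rho (b n) - 1 / J%:R <= 1 - r n.
  by move: ru; rewrite -[(b n).+1]addn1 natrD mulrDl /rho; lra.
by rewrite mulrBr mulr1; lra.
Qed.

(** With [r n] replaced by [(j + 1) / J] on block [j] the sum is at most 0; the weights lose at most
    a fraction [1 / J] by this. *)
Lemma block_weight_tilt_down :
  \sum_n r n * (xi n - block_weight n) <= (\sum_n block_weight n) / J%:R.
Proof.
pose rho (j : 'I_J) : R := j.+1%:R / J%:R.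
have rho0 j : 0 <= rho j by rewrite divr_ge0.
have := sum_xi_le rho0; rewrite -subr_ge0 -sumrB => h.
apply: (@le_trans _ _ (\sum_n (rho (b n) * xi n - rho (b n) * block_weight n +
   block_weight n / J%:R))).
  apply: ler_sum => n _.
  have /andP[rl ru] := rb n.
  have h1 : r n * xi n <= rho (b n) * xi n by rewrite ler_wpM2r.
  have h2 : (b n)%:R / J%:R * block_weight n <= r n * block_weight n.
    by rewrite ler_wpM2r// ltW// block_weight_gt0.
  have h3 : rho (b n) * block_weight n =
      (b n)%:R / J%:R * block_weight n + block_weight n / J%:R.
    by rewrite /rho -[(b n).+1]addn1 natrD !mulrDl mul1r [J%:R^-1 * _]mulrC.
  by rewrite mulrBr; lra.
rewrite big_split/= -mulr_suml -[leRHS]add0r lerD2r.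
by rewrite -oppr_ge0 -sumrN; under eq_bigr do rewrite opprB.
Qed.

End block_weights.

(** * From random centres to coverings of the finite-dimensional ellipsoid *)

Lemma slack_factor_itv (R : realType) (d J : nat) : (0 < J)%N ->
  0 < slack_factor R d J <= 1.
Proof.
move=> J0; have K1 : 1 <= J%:R ^+ 4 :> R by rewrite exprn_ege1// ler1n.
apply/andP; split.
  by rewrite divr_gt0 ?expR_gt0// mulr_gt0// exprn_gt0// ltr0n.
rewrite /slack_factor ler_pdivrMr; last by lra.
apply: (@le_trans _ _ 1); last by lra.
rewrite -[leRHS]expR0 ler_expR -opprD oppr_le0 addr_ge0//.
apply: mulr_ge0; last exact: sqrtr_ge0.
by apply: addr_ge0 => //; apply: ln_ge0; lra.
Qed.

(** The law of the centres depends only on the profile [T], so one greedy choice serves every point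
    that fits it. Since [X] is finite, a single grid size [M] works for all its points. *)
Lemma profile_cover (R : realType) (d J N : nat) (e : R) (m : 'I_d -> R)
    (b : 'I_d -> 'I_J) (T : 'I_J -> R) (X : finType) (pt : X -> 'I_d -> R) :
  (0 < d)%N -> (0 < J)%N -> 0 < e -> (forall n, e < m n) ->
  (forall n, (b n)%:R / J%:R <= (e / m n) ^+ 2 <= ((b n).+1)%:R / J%:R) ->
  (forall j, 1 / J%:R ^+ 2 <= T j <= 2) ->
  ln #|X|%:R < (\prod_n (e / m n)) * slack_factor R d J * N%:R ->
  exists s : 'I_N -> 'I_d -> R, forall x,
    (forall j, \sum_(n | b n == j) (pt x n / m n) ^+ 2 <= T j) ->
    exists i, \sum_n (pt x n - s i n) ^+ 2 <=
      e ^+ 2 * (1 + J%:R^-1) ^+ 3 * \sum_j T j.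
Proof.
move=> d0 J0 e0 em rb TJ lnX.
have J0' : 0 < J%:R :> R by rewrite ltr0n.
have T0 j : 0 < T j.
  by have /andP[+ _] := TJ j; apply: lt_le_trans; rewrite divr_gt0// exprn_gt0.
pose w := block_weight b T.
pose hi := e ^+ 2 * (1 + J%:R^-1) ^+ 3 * \sum_n w n.
pose W (y : 'I_d -> R) :=
    expR (- \sum_n ((2 * w n * (m n ^+ 2 - e ^+ 2))^-1 * y n ^+ 2)).
pose p := (\prod_n (e / m n)) * slack_factor R d J.
have r01 n : 0 < (e / m n) ^+ 2 < 1 by exact: coord_r01.
have nearM : \forall M \near \oo, forall x : X,
    (forall j, \sum_(n | b n == j) (pt x n / m n) ^+ 2 <= T j) ->
    0 < grid_sum M W /\ p * grid_sum M W <=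
    grid_sum M (fun y => W y * (\sum_n (pt x n - y n) ^+ 2 <= hi)%R%:R).
  apply: filter_forall => x.
  have [xT|nxT] := pselect (forall j, \sum_(n | b n == j) (pt x n / m n) ^+ 2 <= T j);
    last by near=> M.
  have xi0 n : 0 <= (pt x n / m n) ^+ 2 by exact: sqr_ge0.
  have h : \forall M \near \oo, 0 < grid_sum M W /\ p * grid_sum M W <=
      grid_sum M (fun y => W y * (\sum_n (pt x n - y n) ^+ 2 <= hi)%R%:R).
    apply: grid_cover_prob => //.
    - by move=> n; exact: block_weight_gt0.
    - move=> n; apply: le_trans (block_weight_le b T0 n) _.
      by have /andP[] := TJ (b n).
    - by apply: block_weight_tilt_up.
    - by apply: block_weight_tilt_down.
    - exact: block_weight_ratio.
    - by apply: sum_block_weight_ge => // j; have /andP[] := TJ j.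
  by near=> M => _; near: M.
have [M HM] : exists M, forall x : X,
    (forall j, \sum_(n | b n == j) (pt x n / m n) ^+ 2 <= T j) ->
    0 < grid_sum M W /\ p * grid_sum M W <=
    grid_sum M (fun y => W y * (\sum_n (pt x n - y n) ^+ 2 <= hi)%R%:R).
  by near \oo => M; exists M; near: M; exact: nearM.
pose A := [set x : X | [forall j, \sum_(n | b n == j) (pt x n / m n) ^+ 2 <= T j]]%SET.
have AP x : reflect (forall j, \sum_(n | b n == j) (pt x n / m n) ^+ 2 <= T j) (x \in A).
  by rewrite inE; exact: forallP.
(* If no point fits the profile, any centres do; otherwise [x0] shows that the weights have positive
   sum. *)
have [A0|[x0 x0A]] := set_0Vmem A.
  exists (fun _ _ => 0) => x /AP; by rewrite A0 inE.
pose Y := {ffun 'I_d -> 'I_(2 * M ^ 3)}.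
pose py (f : Y) n := grid_pt R M (f n).
have [gs0 _] := HM _ (AP _ x0A).
have f0 : 0 < ((M%:R ^+ 2)^-1) ^+ d :> R.
  rewrite lt_def exprn_ge0 ?invr_ge0 ?sqr_ge0// andbT; apply/eqP => f0.
  by move: gs0; rewrite /grid_sum f0 mul0r ltxx.
have W0 : 0 < \sum_(f : Y) W (py f) by move: gs0; rewrite pmulr_rgt0.
have p01 : 0 <= p <= 1.
  have /andP[s0 s1] := @slack_factor_itv R d J J0.
  have em0 n : 0 <= e / m n <= 1.
    have mn0 := lt_trans e0 (em n).
    by rewrite divr_ge0 ?(ltW e0) ?(ltW mn0)//= ler_pdivrMr// mul1r ltW.
  have P0 : 0 <= \prod_n (e / m n).
    by apply: prodr_ge0 => n _; have /andP[] := em0 n.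
  rewrite mulr_ge0 ?(ltW s0)//= mulr_ile1 ?(ltW s0)//.
  by apply: prodr_ile1 => n _; exact: em0.
have pA x : x \in A -> p * \sum_(f : Y) W (py f) <=
    \sum_(f : Y | (\sum_n (pt x n - py f n) ^+ 2 <= hi)%R) W (py f).
  move=> /AP/HM[_]; rewrite /grid_sum mulrCA ler_pM2l// => /le_trans; apply.
  rewrite [leRHS]big_mkcond/=; apply: ler_sum => f _.
  by case: ifP; rewrite ?mulr1 ?mulr0.
have lnA : ln #|A|%:R < p * N%:R.
  apply: le_lt_trans lnX; rewrite ler_ln ?posrE ?ltr0n ?ler_nat ?max_card//.
    by apply/card_gt0P; exists x0.
  by apply/card_gt0P; exists x0.
have [s sP] := greedy_cover p01 (fun f => expR_ge0 _) W0 pA lnA.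
exists (fun i => py (tnth s i)) => x /AP /sP/hasP[f /tnthP[i ->] le].
exists i; apply: le_trans le _.
apply: ler_wpM2l.
  by rewrite mulr_ge0 ?sqr_ge0// exprn_ge0// addr_ge0// invr_ge0 ltW.
exact: sum_block_weight_le.
Unshelve. all: by end_near. Qed.

(** Rounding toward zero keeps energies from growing, so a rounded point still fits its profile. The
    shift by [h] encodes the integers from -h to h. *)
Lemma grid_round (R : realType) (eta x : R) (h : nat) :
  0 < eta -> `|x| <= h%:R * eta ->
  exists k : 'I_(2 * h).+1, (eta * (k%:R - h%:R)) ^+ 2 <= x ^+ 2 /\
    (x - eta * (k%:R - h%:R)) ^+ 2 <= eta ^+ 2.
Proof.
move=> eta0 xh; pose f := Num.truncn (`|x| / eta).
have x0 : 0 <= `|x| / eta by rewrite divr_ge0// ltW.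
have /andP[f1 f2] := truncn_itv x0.
have {}f1 : f%:R * eta <= `|x| by rewrite -ler_pdivlMr.
have {}f2 : `|x| < f%:R * eta + eta.
  by rewrite -[X in _ + X]mul1r -mulrDl natr1 -ltr_pdivrMr.
have fh : (f <= h)%N by rewrite -(ler_nat R) -(ler_pM2r eta0) (le_trans f1).
have fe0 : 0 <= f%:R * eta by rewrite mulr_ge0// ltW.
have sq (a b : R) : `|a| <= `|b| -> a ^+ 2 <= b ^+ 2.
  by move=> ab; rewrite -(real_normK (num_real a)) -(real_normK (num_real b)) lerXn2r// nnegrE.
have [xge0|xlt0] := leP 0 x.
- have kP : (h + f < (2 * h).+1)%N by rewrite ltnS mul2n -addnn leq_add2l.
  move: f1 f2; rewrite ger0_norm// => f1 f2.
  exists (Ordinal kP); have -> : eta * ((Ordinal kP)%:R - h%:R) = f%:R * eta.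
    by rewrite /= natrD addrAC subrr add0r mulrC.
  split; apply: sq; first by rewrite !ger0_norm.
  by rewrite !ger0_norm ?subr_ge0// ?ltW//; lra.
- have kP : (h - f < (2 * h).+1)%N.
    by rewrite ltnS (leq_trans (leq_subr _ _))// mul2n -addnn leq_addr.
  move: f1 f2; rewrite ltr0_norm// => f1 f2.
  exists (Ordinal kP); have -> : eta * ((Ordinal kP)%:R - h%:R) = - (f%:R * eta).
    by rewrite /= natrB//; ring.
  split; apply: sq; first by rewrite normrN ger0_norm// ltr0_norm.
  by rewrite opprK ler0_norm ?ger0_norm ?(ltW eta0)//; lra.
Qed.

(** Young's inequality; the defect is [K] times a square. *)
Lemma sqr_dist_le (R : realType) (K a b c : R) : 0 < K ->
  (a - c) ^+ 2 <= (1 + K^-1) * (b - c) ^+ 2 + (1 + K) * (a - b) ^+ 2.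
Proof.
move=> K0; rewrite -subr_ge0.
have -> : (1 + K^-1) * (b - c) ^+ 2 + (1 + K) * (a - b) ^+ 2 - (a - c) ^+ 2 =
    K * ((b - c) / K - (a - b)) ^+ 2 by field; rewrite gt_eqF.
by rewrite mulr_ge0 ?sqr_ge0// ltW.
Qed.

Lemma finite_dim_covering_upper (R : realType) (d J : nat) (e B : R)
    (m : 'I_d -> R) :
  (0 < d)%N -> (0 < J)%N -> 0 < e -> (forall n, e < m n) -> (forall n, m n <= B) ->
  exists (I : finType) (y : I -> 'I_d -> R),
    #|I|%:R <= (J%:R ^+ 2 + 1) ^+ J *
      (d%:R * (4 * B * J%:R * d%:R / e + 3) /
       ((\prod_n (e / m n)) * slack_factor R d J) + 1) /\
    forall x : 'I_d -> R, \sum_n (x n / m n) ^+ 2 <= 1 ->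
      exists i, \sum_n (x n - y i n) ^+ 2 + e ^+ 2 * (1 - \sum_n (x n / m n) ^+ 2)
        <= e ^+ 2 * (1 + J%:R^-1) ^+ 6.
Proof.
move=> d0 J0 e0 em mB.
pose K : R := J%:R.
have K0 : 0 < K by rewrite ltr0n.
have K1 : 1 <= K by rewrite ler1n.
have D0 : 0 < d%:R :> R by rewrite ltr0n.
have D1 : 1 <= d%:R :> R by rewrite ler1n.
have m0 n : 0 < m n by exact: lt_trans (em n).
have B0 : 0 < B by exact: lt_le_trans (m0 (Ordinal d0)) _.
(* The mesh makes [(1 + K) d eta^2], the rounding error after Young's inequality, at most
   [e^2 / K]. *)
pose eta := e / (2 * K * d%:R).
have eta0 : 0 < eta by rewrite divr_gt0// !mulr_gt0.
pose h := (Num.truncn (B / eta)).+1.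
have Be0 : 0 <= B / eta by rewrite divr_ge0// ltW.
have hB : B <= h%:R * eta.
  by rewrite -ler_pdivrMr// ltW//; have /andP[] := truncn_itv Be0.
have hle : h%:R <= B / eta + 1.
  by rewrite /h -natr1 lerD2r; have /andP[] := truncn_itv Be0.
pose X := {ffun 'I_d -> 'I_(2 * h).+1}.
pose pt (f : X) n : R := eta * ((f n)%:R - h%:R).
pose p := (\prod_n (e / m n)) * slack_factor R d J.
have p0 : 0 < p.
  have /andP[s0 _] := slack_factor_itv R d J0.
  by rewrite mulr_gt0// prodr_gt0// => n _; rewrite divr_gt0.
(* An upper bound for the logarithm [d ln (2 h + 1)] of the number of grid points, from [ln u < u]
   and [2 B / eta = 4 B K d / e]. *)
pose V := d%:R * (4 * B * K * d%:R / e + 3).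
pose N := (Num.truncn (V / p)).+1.
have V0' : 0 <= V.
  by rewrite mulr_ge0// addr_ge0// divr_ge0 ?(ltW e0)// !mulr_ge0// ltW.
have V0 : 0 <= V / p by rewrite divr_ge0// ltW.
have VN : V < p * N%:R.
  by rewrite mulrC -ltr_pdivrMr//; have /andP[] := truncn_itv V0.
have NV : N%:R <= V / p + 1.
  by rewrite /N -natr1 lerD2r; have /andP[] := truncn_itv V0.
have lnX : ln #|X|%:R < p * N%:R.
  apply: le_lt_trans VN; rewrite card_ffun !card_ord natrX lnXn ?ltr0n//.
  rewrite -[_ *+ d]mulr_natl /V; apply: ler_wpM2l => //.
  apply: (@le_trans _ _ ((2 * h).+1%:R)); first by rewrite ltW// ln_sublinear// ltr0n.
  rewrite -natr1 natrM.
  have -> : 4 * B * K * d%:R / e = 2 * (B / eta).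
    by rewrite /eta; field; rewrite !gt_eqF.
  by move: hle; lra.
have /choice[b bP] (n : 'I_d) : exists j : 'I_J,
    j%:R / J%:R <= (e / m n) ^+ 2 <= (j.+1)%:R / J%:R.
  have /andP[r0 r1] := @coord_r01 R e (m n) e0 (em n).
  have Kr0 : 0 <= K * (e / m n) ^+ 2 by rewrite mulr_ge0// ltW.
  have /andP[tr1 tr2] := truncn_itv Kr0.
  have trJ : (Num.truncn (K * (e / m n) ^+ 2) < J)%N.
    by rewrite -(ltr_nat R); apply: le_lt_trans tr1 _; rewrite gtr_pMr.
  exists (Ordinal trJ) => /=.
  by rewrite ler_pdivrMr// ler_pdivlMr// [_ * J%:R]mulrC tr1/= ltW.
(* Block energies are rounded up to positive multiples of [1 / J^2], which adds at most [1 / J] over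
   the [J] blocks. *)
pose P := {ffun 'I_J -> 'I_(J ^ 2).+1}.
pose T (f : P) j : R := (f j).+1%:R / K ^+ 2.
have TP f j : 1 / J%:R ^+ 2 <= T f j <= 2.
  have K20 : 0 < K ^+ 2 by rewrite exprn_gt0.
  rewrite /T ler_pM2r ?invr_gt0// ler1n/= ler_pdivrMr//.
  have : (f j).+1%:R <= (J ^ 2).+1%:R :> R by rewrite ler_nat.
  have : 1 <= K ^+ 2 by rewrite exprn_ege1.
  by rewrite -[(J ^ 2).+1%:R]natr1 natrX -/K; lra.
have [s sP] := choice (fun f : P =>
  @profile_cover R d J N e m b (T f) X pt d0 J0 e0 em bP (TP f) lnX).
exists (P * 'I_N)%type, (fun i => s i.1 i.2); split.
  rewrite card_prod card_ffun !card_ord natrM natrX -natr1 natrX.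
  by apply: ler_wpM2l => //; rewrite exprn_ge0// addr_ge0// sqr_ge0.
move=> x x1.
pose t j := \sum_(n | b n == j) (x n / m n) ^+ 2.
have tE : \sum_n (x n / m n) ^+ 2 = \sum_j t j by rewrite (partition_big b xpredT).
have t0 j : 0 <= t j by apply: sumr_ge0 => n _; exact: sqr_ge0.
have t1 j : t j <= 1.
  apply: le_trans x1; rewrite tE (bigD1 j)//= lerDl.
  exact: sumr_ge0.
have [f fP] : exists f : P, forall j, t j <= T f j <= t j + (K ^+ 2)^-1.
  have K20 : 0 < K ^+ 2 by rewrite exprn_gt0.
  have Kt0 j : 0 <= K ^+ 2 * t j by rewrite mulr_ge0// ltW.
  have trJ j : (Num.truncn (K ^+ 2 * t j) < (J ^ 2).+1)%N.
    have /andP[tr1 _] := truncn_itv (Kt0 j).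
    rewrite ltnS -(ler_nat R) natrX; apply: le_trans tr1 _.
    by rewrite ger_pMr.
  exists [ffun j => Ordinal (trJ j)] => j; rewrite /T ffunE /=.
  have /andP[tr1 tr2] := truncn_itv (Kt0 j).
  rewrite ler_pdivlMr// [t j * _]mulrC (ltW tr2)/=.
  by rewrite -natr1 mulrDl mul1r lerD2r ler_pdivrMr// [t j * _]mulrC.
have [g gP] : exists g : X, forall n, (pt g n) ^+ 2 <= x n ^+ 2 /\
    (x n - pt g n) ^+ 2 <= eta ^+ 2.
  have xB n : `|x n| <= h%:R * eta.
    apply: le_trans hB; apply: le_trans (mB n).
    have : (x n / m n) ^+ 2 <= 1.
      apply: le_trans x1; rewrite (bigD1 n)//= lerDl.
      by apply: sumr_ge0 => k _; exact: sqr_ge0.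
    rewrite -(real_normK (num_real _)) expr_le1// normrM normfV (gtr0_norm (m0 n)).
    by rewrite ler_pdivrMr// mul1r.
  have [g gP] := choice (fun n => grid_round eta0 (xB n)).
  by exists (finfun g) => n; rewrite /pt ffunE; exact: gP.
have [|i iP] := sP f g.
  move=> j; have /andP[+ _] := fP j; apply: le_trans.
  apply: ler_sum => n _; rewrite !expr_div_n ler_pM2r ?invr_gt0 ?exprn_gt0//.
  by have [] := gP n.
exists (f, i) => /=; rewrite tE.
set tt := \sum_j t j in tE *.
have ST : \sum_j T f j <= tt + K^-1.
  apply: (@le_trans _ _ (\sum_j (t j + (K ^+ 2)^-1))).
    by apply: ler_sum => j _; have /andP[] := fP j.
  rewrite big_split/= sumr_const card_ord -[_ *+ J]mulr_natl lerD2l.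
  by rewrite le_eqVlt; apply/orP; left; apply/eqP; field; rewrite gt_eqF.
have S1 : \sum_n (x n - s f i n) ^+ 2 <=
    (1 + K^-1) * (\sum_n (pt g n - s f i n) ^+ 2) + (1 + K) * (d%:R * eta ^+ 2).
  have -> : d%:R * eta ^+ 2 = \sum_(n < d) eta ^+ 2.
    by rewrite sumr_const card_ord mulr_natl.
  rewrite !mulr_sumr -big_split/=; apply: ler_sum => n _.
  apply: le_trans (sqr_dist_le _ (pt g n) _ K0) _; rewrite lerD2l.
  by apply: ler_wpM2l; [lra|have [] := gP n].
have S2 : (1 + K) * (d%:R * eta ^+ 2) <= e ^+ 2 * K^-1.
  have -> : (1 + K) * (d%:R * eta ^+ 2) = e ^+ 2 * K^-1 * ((1 + K) / (4 * K * d%:R)).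
    by rewrite /eta; field; rewrite !gt_eqF.
  rewrite ler_piMr//; first by rewrite divr_ge0 ?sqr_ge0// ltW.
  rewrite ler_pdivrMr ?mulr_gt0// mul1r.
  have : K * 1 <= K * d%:R by rewrite ler_pM2l.
  by lra.
set u := K^-1 in iP ST S1 S2 *.
have u0 : 0 < u by rewrite invr_gt0.
have tt1 : tt <= 1 by rewrite -tE.
have S3 : \sum_n (pt g n - s f i n) ^+ 2 <= e ^+ 2 * ((1 + u) ^+ 3 * (tt + u)).
  apply: le_trans iP _; rewrite -mulrA; apply: ler_wpM2l; first exact: sqr_ge0.
  by apply: ler_wpM2l => //; rewrite exprn_ge0//; lra.
have S4 : (1 + u) * (\sum_n (pt g n - s f i n) ^+ 2) <= e ^+ 2 * ((1 + u) ^+ 4 * (tt + u)).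
  have -> : e ^+ 2 * ((1 + u) ^+ 4 * (tt + u)) =
    (1 + u) * (e ^+ 2 * ((1 + u) ^+ 3 * (tt + u))) by ring.
  by apply: ler_wpM2l => //; lra.
apply: (@le_trans _ _ (e ^+ 2 * ((1 + u) ^+ 4 * (tt + u)) + e ^+ 2 * u + e ^+ 2 * (1 - tt))).
  by rewrite lerD2r; lra.
rewrite -!mulrDr; apply: ler_wpM2l; first exact: sqr_ge0.
have q4 : 1 <= (1 + u) ^+ 4 by rewrite exprn_ege1//; lra.
(* The left side is nondecreasing in the energy [tt], so the extreme case is [tt = 1]. *)
have : (1 + u) ^+ 4 * (tt + u) - tt <= (1 + u) ^+ 4 * (1 + u) - 1.
  rewrite -subr_ge0.
  have -> : (1 + u) ^+ 4 * (1 + u) - 1 - ((1 + u) ^+ 4 * (tt + u) - tt) =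
    ((1 + u) ^+ 4 - 1) * (1 - tt) by ring.
  by rewrite mulr_ge0 ?subr_ge0.
have : u <= (1 + u) ^+ 4 * (1 + u) * u.
  rewrite ler_peMl ?(ltW u0)// mulr_ege1//; lra.
have -> : (1 + u) ^+ 6 = (1 + u) ^+ 4 * (1 + u) * u + (1 + u) ^+ 4 * (1 + u) by ring.
by lra.
Qed.

(** * Coverings of ellipsoids of l2 *)

Lemma nneseries_le_partial (R : realType) (u : nat -> R) (C : R) :
  (forall k, 0 <= u k) ->
  (\sum_(0 <= k <oo) (u k)%:E <= C%:E)%E <-> forall n, \sum_(k < n) u k <= C.
Proof.
move=> u0; have u0' k : (0 <= (u k)%:E)%E by rewrite lee_fin.
split=> [uC n|uC].
  rewrite -lee_fin; apply: le_trans uC.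
  have := @nneseries_lim_ge R (EFin \o u) xpredT 0%N n (fun k _ _ => u0' k).
  by rewrite sumEFin big_mkord.
apply: lime_le; first exact: is_cvg_nneseries.
by apply: nearW => n; rewrite sumEFin big_mkord lee_fin.
Qed.

Lemma l2norm_le (R : realType) (x : nat -> R) (e : R) : 0 <= e ->
  (l2norm x <= e%:E)%E <-> forall n, \sum_(k < n) x k ^+ 2 <= e ^+ 2.
Proof.
move=> e0; rewrite /l2norm Lnorm_counting//.
have -> : (\sum_(k <oo) (`|(EFin \o x) k| `^ 2)%E)%E =
    (\sum_(0 <= k <oo) (x k ^+ 2)%:E)%E.
  apply: eq_eseriesr => k _.
  by rewrite /= ?poweR_EFin powR_mulrn// real_normK// num_real.
have S0 : (0 <= \sum_(0 <= k <oo) (x k ^+ 2)%:E)%E.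
  by apply: nneseries_ge0 => k _ _; rewrite lee_fin sqr_ge0.
rewrite poweR12_sqrt//; apply: (iff_trans _ (nneseries_le_partial _ (fun k => sqr_ge0 (x k)))).
move: (\sum_(0 <= k <oo) _)%E S0 => [r r0| //|//].
rewrite /= !lee_fin; split=> [re|re].
  by rewrite -[r]sqr_sqrtr// lerXn2r// nnegrE sqrtr_ge0.
by rewrite -(ger0_norm e0) -sqrtr_sqr ler_wsqrtr.
Qed.

Lemma ellipsoid2P (R : realType) (mu x : nat -> R) :
  (forall k, 0 < mu k) -> (exists B, forall k, mu k <= B) ->
  ellipsoid2 mu x <-> forall n, \sum_(k < n) (x k / mu k) ^+ 2 <= 1.
Proof.
move=> mu0 [B muB].
have E : (\sum_(0 <= k <oo) (`|x k / mu k| ^+ 2)%:E)%E =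
    (\sum_(0 <= k <oo) ((x k / mu k) ^+ 2)%:E)%E.
  by apply: eq_eseriesr => k _; rewrite real_normK// num_real.
have P := nneseries_le_partial 1 (fun k => sqr_ge0 (x k / mu k)).
split=> [[_]|xmu]; first by rewrite E => /P.
split; last by rewrite E; exact/P.
have B0 : 0 <= B by exact: le_trans (ltW (mu0 0%N)) (muB _).
(* Square summability comes from [x_k^2 <= B^2 (x_k / mu_k)^2]. *)
rewrite /l2 /=; apply: (@le_lt_trans _ _ B%:E); last exact: ltry.
apply/l2norm_le => // n.
apply: (@le_trans _ _ (\sum_(k < n) B ^+ 2 * (x k / mu k) ^+ 2)).
  apply: ler_sum => k _; rewrite -exprMn.
  rewrite -(real_normK (num_real (x k))) -(real_normK (num_real (B * _))).
  rewrite lerXn2r ?nnegrE// normrM normrM normfV (gtr0_norm (mu0 k)) (ger0_norm B0).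
  by rewrite mulrCA ler_peMr// ler_pdivlMr// mul1r.
by rewrite -mulr_sumr -[leRHS]mulr1 ler_wpM2l// sqr_ge0.
Qed.

Lemma covering_number_nat (R : realType) (e : R) (K A : set (nat -> R)) :
  finite_set A -> is_covering e K A -> exists N : nat, covering_number e K = N%:R%:E /\
    (exists A', (A' #= `I_N)%card /\ is_covering e K A') /\
    forall N' A', (A' #= `I_N')%card -> is_covering e K A' -> (N <= N')%N.
Proof.
move=> [N0 AN0] Acov.
pose P N := `[< exists A, (A #= `I_N)%card /\ is_covering e K A >].
have exP : exists N, P N by exists N0; apply/asboolP; exists A.
have [N /asboolP PN minN] := ex_minnP exP.
exists N; split; last first.
  by split=> // N' A' AN' Acov'; apply: minN; apply/asboolP; exists A'.
apply/eqP; rewrite eq_le; apply/andP; split.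
  by apply: ereal_inf_lbound; exists N.
apply: le_ereal_inf_tmp => _ [N' PN' <-].
by rewrite lee_fin ler_nat minN//; apply/asboolP.
Qed.

Lemma metric_entropy_nat (R : realType) (e : R) (K : set (nat -> R)) (N : nat) :
  (0 < N)%N -> covering_number e K = N%:R%:E ->
  fine (metric_entropy e K) = ln N%:R / ln 2.
Proof.
by move=> N0 E; rewrite /metric_entropy E lne_EFin ?ltr0n.
Qed.

Lemma sum_ln_prod (R : realType) (d : nat) (u : nat -> R) : (forall k, 0 < u k) ->
  ln (\prod_(k < d) u k) = \sum_(k < d) ln (u k).
Proof.
move=> u0; apply: expR_inj; rewrite lnK ?posrE ?prodr_gt0// expR_sum.
by apply: eq_bigr => k _; rewrite lnK// posrE.
Qed.

Definition zero_extend (R : realType) (d : nat) (y : 'I_d -> R) (k : nat) : R :=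
  oapp y 0 (insub k).

Lemma zero_extend_ord (R : realType) (d : nat) (y : 'I_d -> R) (k : 'I_d) :
  zero_extend y k = y k.
Proof. by rewrite /zero_extend valK. Qed.

Lemma zero_extend_out (R : realType) (d : nat) (y : 'I_d -> R) (k : nat) :
  (d <= k)%N -> zero_extend y k = 0.
Proof. by move=> dk; rewrite /zero_extend insubN// -leqNgt. Qed.

Lemma sum_ord_mono (R : realType) (u : nat -> R) (n d : nat) :
  (forall k, 0 <= u k) -> (n <= d)%N -> \sum_(k < n) u k <= \sum_(k < d) u k.
Proof.
move=> u0 nd; rewrite -(subnKC nd) big_split_ord/= lerDl.
exact: sumr_ge0.
Qed.

Lemma sum_zero_extend (R : realType) (d n : nat) (F : nat -> R -> R)
    (y : 'I_d -> R) : (forall k, F k 0 = 0) -> (d <= n)%N ->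
  \sum_(k < n) F k (zero_extend y k) = \sum_(k < d) F k (y k).
Proof.
move=> F0 dn; rewrite -(subnKC dn) big_split_ord/= [X in _ + X]big1.
  by rewrite addr0; apply: eq_bigr => k _; rewrite zero_extend_ord.
by move=> k _; rewrite zero_extend_out ?leq_addr// F0.
Qed.

(** The finite-dimensional ellipsoid, extended by zero, sits in the full one, and dropping
    coordinates of the centres only lowers distances. *)
Lemma ellipsoid_covering_lower (R : realType) (mu : nat -> R) (e : R) (d N : nat)
    (A : set (nat -> R)) :
  (forall k, 0 < mu k) -> (exists B, forall k, mu k <= B) -> 0 < e -> (36 <= d)%N ->
  (A #= `I_N)%card -> is_covering e (ellipsoid2 mu) A ->
  (0 < N)%N /\
  \sum_(k < d) ln (mu k / e) - 12 * Num.sqrt d%:R - ln 2 <= ln N%:R.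
Proof.
move=> mu0 muB e0 d36 /card_esym/card_set_bijP[f [fA _ fsurj]] [_ cov].
have h := @finite_dim_covering_lower R d N e (fun k => mu k)
  (fun i k => f i k) d36 e0 (fun k => mu0 k).
have {}h : \prod_(n < d) (mu n / e) * expR (- (12 * Num.sqrt d%:R)) / 2 <= N%:R.
  apply: h => x x1.
  have /cov[y /fsurj[i iN <-]] : ellipsoid2 mu (zero_extend x).
    apply/ellipsoid2P => // n.
    have u0 k : 0 <= (zero_extend x k / mu k) ^+ 2 by exact: sqr_ge0.
    apply: le_trans (sum_ord_mono u0 (leq_addr d n)) _.
    rewrite (sum_zero_extend (F := fun k z => (z / mu k) ^+ 2)) ?leq_addl//.
    by move=> k; rewrite mul0r expr0n.
  move/l2norm_le => /(_ (ltW e0) d) le; exists (Ordinal iN).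
  by apply: le_trans le; apply: ler_sum => k _ /=; rewrite zero_extend_ord.
have P0 : 0 < \prod_(n < d) (mu n / e) by apply: prodr_gt0 => n _; rewrite divr_gt0.
have N0 : 0 < N%:R :> R.
  by apply: lt_le_trans h; rewrite divr_gt0// mulr_gt0// expR_gt0.
split; first by rewrite ltr0n in N0.
have lnP : ln (\prod_(n < d) (mu n / e)) = \sum_(k < d) ln (mu k / e).
  by apply: (sum_ln_prod d (u := fun k => mu k / e)) => k; rewrite divr_gt0.
move: h; rewrite -ler_ln ?posrE ?divr_gt0 ?mulr_gt0 ?expR_gt0//.
by rewrite ln_div ?posrE ?mulr_gt0 ?expR_gt0// lnM ?posrE ?expR_gt0// expRK lnP.
Qed.

(** Centres vanish beyond [d]; there [x_k^2 <= e^2 (x_k / mu_k)^2], so the tail costs at most [e^2]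
    times the energy left by the first [d] coordinates. *)
Lemma ellipsoid_covering_upper (R : realType) (mu : nat -> R) (e B : R) (d J : nat) :
  (forall k, 0 < mu k) -> (forall k, mu k <= B) -> 0 < e -> (0 < d)%N -> (0 < J)%N ->
  (forall k, (k < d)%N -> e < mu k) -> (forall k, (d <= k)%N -> mu k <= e) ->
  exists N A, [/\ (A #= `I_N)%card,
    is_covering (e * (1 + J%:R^-1) ^+ 3) (ellipsoid2 mu) A &
    N%:R <= (J%:R ^+ 2 + 1) ^+ J *
      (d%:R * (4 * B * J%:R * d%:R / e + 3) /
       ((\prod_(n < d) (e / mu n)) * slack_factor R d J) + 1)].
Proof.
move=> mu0 muB e0 d0 J0 mud mud'.
have [I [y [cardI cov]]] := @finite_dim_covering_upper R d J e B (fun k => mu k) d0 J0 e0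
   (fun k => mud k (ltn_ord k)) (fun k => muB k).
(* Covering the origin shows that [I] is inhabited; [i0] is the default value of [nth]. *)
have [|i0 _] := cov (fun=> 0).
  by rewrite big1// => k _; rewrite mul0r expr0n.
pose Ze k := zero_extend (y (nth i0 (enum I) k)).
pose A : set (nat -> R) := Ze @` `I_#|I|.
have [N AN] : finite_set A by apply: finite_image; exact: finite_II.
exists N, A; split => //; last first.
  apply: le_trans cardI; rewrite ler_nat -card_le_II.
  apply: card_le_trans (card_image_le Ze _).
  by have /card_eqPle[] := AN.
split.
  move=> _ [i _ <-]; rewrite /l2/=.
  pose s := \sum_(k < d) y (nth i0 (enum I) i) k ^+ 2.
  have s0 : 0 <= s by apply: sumr_ge0 => k _; exact: sqr_ge0.
  (* [s + 1] bounds the norm because [s <= (s + 1)^2]. *)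
  apply: (@le_lt_trans _ _ (s + 1)%:E); last exact: ltry.
  apply/l2norm_le => [|n]; first by rewrite addr_ge0.
  have u0 k : 0 <= Ze i k ^+ 2 by exact: sqr_ge0.
  apply: le_trans (sum_ord_mono u0 (leq_addr d n)) _.
  rewrite (sum_zero_extend (F := fun _ z => z ^+ 2)) ?leq_addl//; last first.
    by move=> k; rewrite expr0n.
  by rewrite -/s; nra.
move=> x /ellipsoid2P => /(_ mu0 (ex_intro _ B muB)) xmu.
have [|i iP] := cov (fun k => x k); first exact: xmu.
exists (Ze (index i (enum I))).
  by exists (index i (enum I)) => //=; rewrite cardE index_mem mem_enum.
have -> : Ze (index i (enum I)) = zero_extend (y i).
  by rewrite /Ze nth_index// mem_enum.
have K0 : 0 < J%:R :> R by rewrite ltr0n.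
apply/l2norm_le => [|n].
  by rewrite mulr_ge0 ?(ltW e0)// exprn_ge0// addr_ge0// invr_ge0 ltW.
have u0 k : 0 <= (x \- zero_extend (y i)) k ^+ 2 by exact: sqr_ge0.
apply: le_trans (sum_ord_mono u0 (leq_addl d n)) _.
rewrite exprMn -exprM; apply: le_trans iP.
rewrite big_split_ord/= lerD//.
  by under eq_bigr do rewrite zero_extend_ord.
under eq_bigr do rewrite zero_extend_out ?leq_addr// subr0.
apply: (@le_trans _ _ (\sum_(k < n) e ^+ 2 * (x (d + k)%N / mu (d + k)%N) ^+ 2)).
  apply: ler_sum => k _.
  rewrite expr_div_n mulrA ler_pdivlMr ?exprn_gt0// mulrC.
  by rewrite ler_wpM2r ?sqr_ge0// lerXn2r ?nnegrE ?(ltW e0) ?(ltW (mu0 _))// mud'// leq_addr.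
rewrite -mulr_sumr ler_wpM2l ?sqr_ge0// lerBrDl.
by have := xmu (d + n)%N; rewrite big_split_ord.
Qed.

(** * Asymptotics *)

(** Take the tangent of exp at [t = p ln z], evaluate it at [ln z] and at 0, and average with
    weights [p] and [1 - p]. *)
Lemma powR_bernoulli (R : realType) (z p : R) : 0 < z -> 0 < p <= 1 ->
  z `^ p <= 1 + p * (z - 1).
Proof.
move=> z0 /andP[p0 p1]; rewrite /powR gt_eqF//; set t := p * ln z.
have h1 : expR t * (1 + (ln z - t)) <= z.
  by rewrite -[leRHS](lnK z0) -[ln z in leRHS](subrKC t) expRD ler_wpM2l ?expR_ge0 ?expR_ge1Dx.
have h2 : expR t * (1 - t) <= 1.
  rewrite -[leRHS](expRxMexpNx_1 t) ler_wpM2l ?expR_ge0 ?expR_ge1Dx//.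
have h3 := ler_wpM2l (ltW p0) h1.
have h4 : (1 - p) * (expR t * (1 - t)) <= (1 - p) * 1.
  by rewrite ler_wpM2l// subr_ge0.
have : expR t = p * (expR t * (1 + (ln z - t))) + (1 - p) * (expR t * (1 - t)).
  by rewrite /t; ring.
by lra.
Qed.

Lemma powR_sub1 (R : realType) (y p : R) : 0 < y -> y `^ (p - 1) = y `^ p / y.
Proof. by move=> y0; rewrite powRB ?powRr1 ?(ltW y0)// (gt_eqF y0) implybT. Qed.

Lemma powR_increment_ge (R : realType) (k : nat) (p : R) : 0 < p <= 1 ->
  p * k.+1%:R `^ (p - 1) <= k.+1%:R `^ p - k%:R `^ p.
Proof.
move=> p01; have /andP[p0 p1] := p01; rewrite powR_sub1 ?ltr0n//.
case: k => [|k]; first by rewrite powR1 powR0 ?gt_eqF// divr1 mulr1 subr0.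
rewrite -[k.+2%:R]natr1; move: (ltr0Sn R k) => y0.
move: (k.+1%:R : R) y0 => y y0.
have z0 : 0 < y + 1 by rewrite addr_gt0.
have h : (y / (y + 1)) `^ p <= 1 + p * (y / (y + 1) - 1).
  by apply: powR_bernoulli => //; rewrite divr_gt0.
have yE : y `^ p = (y + 1) `^ p * (y / (y + 1)) `^ p.
  by rewrite -powRM ?divr_ge0 ?(ltW z0) ?(ltW y0)// mulrC divfK// gt_eqF.
rewrite yE; have := ler_wpM2l (powR_ge0 (y + 1) p) h.
have -> : y / (y + 1) - 1 = - (y + 1)^-1 by field; rewrite gt_eqF.
by lra.
Qed.

Lemma powR_increment_le (R : realType) (y p : R) : 0 < y -> 0 < p <= 1 ->
  (y + 1) `^ p - y `^ p <= p * y `^ (p - 1).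
Proof.
move=> y0 p01; have /andP[p0 p1] := p01; rewrite powR_sub1//.
have yy : 0 < 1 + y^-1 by rewrite addr_gt0// invr_gt0.
have -> : y + 1 = y * (1 + y^-1) by rewrite mulrDr mulr1 divff// gt_eqF.
rewrite powRM ?(ltW y0) ?(ltW yy)//.
have h : (1 + y^-1) `^ p <= 1 + p * (1 + y^-1 - 1) by exact: powR_bernoulli.
have := ler_wpM2l (powR_ge0 y p) h; rewrite addrAC subrr add0r; lra.
Qed.

(** Concavity compares each term with an increment of the p-th power on either side; telescoping
    puts [p] times the sum between [d^p - 1] and [d^p]. *)
Lemma sum_powR (R : realType) (d : nat) (p : R) : 0 < p <= 1 ->
  `|\sum_(k < d) k.+1%:R `^ (p - 1) - d%:R `^ p / p| <= 1 / p.
Proof.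
move=> p01; have /andP[p0 p1] := p01.
have up : p * \sum_(k < d) k.+1%:R `^ (p - 1) <= d%:R `^ p.
  rewrite mulr_sumr; apply: (@le_trans _ _ (\sum_(0 <= k < d) (k.+1%:R `^ p - k%:R `^ p))).
    by rewrite big_mkord; apply: ler_sum => k _; exact: powR_increment_ge.
  by rewrite telescope_sumr// powR0 ?subr0// gt_eqF.
have lo : d%:R `^ p - 1 <= p * \sum_(k < d) k.+1%:R `^ (p - 1).
  rewrite mulr_sumr; apply: (@le_trans _ _ (\sum_(0 <= k < d) (k.+2%:R `^ p - k.+1%:R `^ p))).
    rewrite (telescope_sumr (fun k => k.+1%:R `^ p))// powR1 lerD2r.
    by apply: ge0_ler_powR; rewrite ?nnegrE// ?ler_nat// ltW.
  rewrite big_mkord; apply: ler_sum => k _.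
  by rewrite -[k.+2%:R]natr1; apply: powR_increment_le.
rewrite ler_norml; apply/andP; split.
  by rewrite lerBrDr -mulNr -mulrDl ler_pdivrMr// mulrC addrC.
apply: (@le_trans _ _ 0); last by rewrite divr_ge0// ltW.
by rewrite subr_le0 ler_pdivlMr// mulrC.
Qed.

Lemma ln1D_approx (R : realType) (t : R) : `|t| <= 1 / 2 ->
  `|ln (1 + t) - t| <= 2 * t ^+ 2.
Proof.
rewrite ler_norml => /andP[t1 t2]; have t0 : 0 < 1 + t by lra.
have up : ln (1 + t) <= t by apply: le_ln1Dx; lra.
have : ln (1 + - (t / (1 + t))) <= - (t / (1 + t)).
  by apply: le_ln1Dx; rewrite ltrN2 ltr_pdivrMr// mul1r; lra.
have -> : 1 + - (t / (1 + t)) = (1 + t)^-1 by field; lra.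
rewrite lnV ?posrE// lerN2 => lo.
have : t - 2 * t ^+ 2 <= t / (1 + t).
  rewrite ler_pdivlMr// -subr_ge0.
  have -> : t - (t - 2 * t ^+ 2) * (1 + t) = t ^+ 2 * (1 + 2 * t) by ring.
  by rewrite mulr_ge0 ?sqr_ge0//; lra.
by rewrite ler_norml => ?; have := sqr_ge0 t; lra.
Qed.

Definition lnfact (R : realType) (d : nat) : R := \sum_(k < d) ln k.+1%:R.

(** [x^d / d!] is one term of the series of exp x. *)
Lemma lnfact_lower (R : realType) (x : R) (d : nat) : 0 < x ->
  d%:R * ln x - lnfact R d <= x.
Proof.
move=> x0; have -> : lnfact R d = ln d`!%:R.
  elim: d => [|d IH]; first by rewrite /lnfact big_ord0 ln1.
  rewrite /lnfact big_ord_recr/= -/(lnfact R d) IH factS natrM.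
  by rewrite lnM ?posrE ?ltr0n ?fact_gt0// addrC.
case: d => [|d]; first by rewrite mul0r ln1 subr0 ltW.
rewrite mulr_natl -lnXn// -ln_div ?posrE ?exprn_gt0 ?ltr0n ?fact_gt0//.
rewrite -ler_expR lnK; last by rewrite posrE divr_gt0 ?exprn_gt0 ?ltr0n ?fact_gt0.
by apply: le_trans (expR_ge1Dxn d (ltW x0)); rewrite lerDr.
Qed.

(** Stirling's bound up to O(ln d); the induction step is [ln (1 - v) <= - v] with [v] the inverse
    of the new index. *)
Lemma lnfact_upper (R : realType) (d : nat) : (0 < d)%N ->
  lnfact R d <= (d%:R + 1) * ln d%:R + 1 - d%:R.
Proof.
case: d => // d _; elim: d => [|d IH].
  by rewrite /lnfact big_ord1 ln1 mulr0 add0r subrr.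
rewrite /lnfact big_ord_recr/= -/(lnfact R d.+1).
have D0 : 0 < d.+1%:R :> R by rewrite ltr0n.
have : ln (1 + - (d.+2%:R)^-1) <= - (d.+2%:R)^-1 :> R.
  by apply: le_ln1Dx; rewrite ltrN2 invf_lt1 ?ltr0n// ltr1n.
have -> : 1 + - (d.+2%:R)^-1 = d.+1%:R / d.+2%:R :> R.
  by rewrite -[d.+2%:R]natr1; field; lra.
rewrite ln_div ?posrE ?ltr0n// => h.
have := ler_wpM2l (ler0n R d.+2) h; rewrite mulrN divff//.
by move: IH; rewrite -[d.+2%:R]natr1; lra.
Qed.

Lemma near_powR_ge (R : realType) (p C : R) : 0 < p ->
  \forall x \near +oo, C <= x `^ p.
Proof.
move=> p0; near=> x.
have C0 : 0 <= `|C| + 1 by rewrite addr_ge0.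
apply: (@le_trans _ _ (`|C| + 1)); first by rewrite (le_trans (ler_norm C))// lerDl.
have xC : (`|C| + 1) `^ p^-1 <= x.
  by near: x; apply: nbhs_pinfty_ge; exact: num_real.
rewrite -[leLHS]powRr1// -(mulVf (lt0r_neq0 p0)) powRrM.
by apply: ge0_ler_powR => //; rewrite ?nnegrE ?powR_ge0 ?(ltW p0)// (le_trans _ xC) ?powR_ge0.
Unshelve. all: by end_near. Qed.

Lemma nearn_powR_ge (R : realType) (p C : R) : 0 < p ->
  \forall d \near \oo, C <= d%:R `^ p.
Proof. by move=> p0; exact: (@cvgr_idn R _ (near_powR_ge C p0)). Qed.

(** The surplus [p - 1 / 2] is halved: one [x^de] absorbs the logarithm, the other the constants. *)
Lemma near_log_sqrt_le (R : realType) (p C ka : R) : 1 / 2 < p -> 0 < ka ->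
  \forall x \near +oo, C * ((1 + ln x) * Num.sqrt x) <= ka * x `^ p.
Proof.
move=> p12 ka0; pose de := (p - 1 / 2) / 2.
have de0 : 0 < de by rewrite /de; lra.
pose C' : R := `|C| * (1 + de^-1).
near=> x.
have x1 : 1 <= x by near: x; apply: nbhs_pinfty_ge; exact: num_real.
have x0 : 0 < x by apply: lt_le_trans x1.
have lnx : 0 <= ln x by rewrite ln_ge0.
have xde : 1 <= x `^ de.
  have E1 : 1 `^ de = 1 :> R by rewrite powR1.
  by rewrite -[leLHS]E1; apply: ge0_ler_powR; rewrite ?nnegrE// ltW.
have h1 : 1 + ln x <= (1 + de^-1) * x `^ de.
  have := ltW (ln_sublinear (powR_gt0 de x0)); rewrite ln_powR => h.
  have : ln x <= de^-1 * x `^ de by rewrite mulrC ler_pdivlMr// mulrC.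
  by rewrite mulrDl mul1r; lra.
apply: (@le_trans _ _ (`|C| * ((1 + ln x) * Num.sqrt x))).
  by rewrite ler_wpM2r ?ler_norm// mulr_ge0// addr_ge0.
apply: (@le_trans _ _ (`|C| * ((1 + de^-1) * x `^ de * Num.sqrt x))).
  by rewrite ler_wpM2l// ler_wpM2r.
have -> : x `^ p = x `^ de * Num.sqrt x * x `^ de.
  rewrite -powR12_sqrt ?(ltW x0)// -!powRD ?(gt_eqF x0) ?implybT//.
  by congr (_ `^ _); rewrite /de; field.
have -> : `|C| * ((1 + de^-1) * x `^ de * Num.sqrt x) =
    C' * (x `^ de * Num.sqrt x) by rewrite /C'; ring.
have -> : ka * (x `^ de * Num.sqrt x * x `^ de) =
  ka * x `^ de * (x `^ de * Num.sqrt x) by ring.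
apply: ler_wpM2r; first by rewrite mulr_ge0 ?powR_ge0.
rewrite -ler_pdivrMl//.
by near: x; exact: near_powR_ge.
Unshelve. all: by end_near. Qed.

(** The terms before [n0] add up to a constant, which [d^p] outgrows; the later ones are summed by
    [sum_powR]. *)
Lemma sum_powR_littleo (R : realType) (v : nat -> R) (k0 p : R) : 0 < p <= 1 ->
  (forall ka, 0 < ka -> \forall k \near \oo,
    `|v k - k0 * k.+1%:R `^ (p - 1)| <= ka * k.+1%:R `^ (p - 1)) ->
  forall ka, 0 < ka -> \forall d \near \oo,
    `|\sum_(k < d) v k - k0 * (d%:R `^ p / p)| <= ka * d%:R `^ p.
Proof.
move=> p01 vP ka ka0; have /andP[p0 p1] := p01.
pose ka1 := ka * p / 2.
have ka10 : 0 < ka1 by rewrite divr_gt0// mulr_gt0.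
have [n0 _ n0P] := vP _ ka10.
pose s k : R := k.+1%:R `^ (p - 1).
pose w k := `|v k - k0 * s k|.
have w0 k : 0 <= w k by exact: normr_ge0.
have s0 k : 0 <= s k by exact: powR_ge0.
pose C1 := \sum_(k < n0) w k + ka1 / p + `|k0| / p.
near=> d.
have n0d : (n0 <= d)%N by near: d; exact: nbhs_infty_ge.
have wd : \sum_(k < d) w k <= \sum_(k < n0) w k + ka1 * \sum_(k < d) s k.
  rewrite -(subnKC n0d) !big_split_ord/= lerD2l mulrDr.
  apply: (@le_trans _ _ (ka1 * \sum_(i < d - n0) s (n0 + i)%N)).
    rewrite mulr_sumr; apply: ler_sum => k _; apply: n0P.
    by rewrite /= leq_addr.
  by rewrite lerDr mulr_ge0 ?sumr_ge0// ltW.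
have := sum_powR d p01; rewrite ler_norml => /andP[sl su].
have sd : \sum_(k < d) s k <= d%:R `^ p / p + 1 / p by rewrite -lerBlDl.
have hw : `|\sum_(k < d) v k - k0 * \sum_(k < d) s k| <= \sum_(k < d) w k.
  by rewrite mulr_sumr -sumrB; exact: ler_norm_sum.
have hk : `|k0 * (\sum_(k < d) s k - d%:R `^ p / p)| <= `|k0| / p.
  rewrite normrM; apply: ler_wpM2l => //.
  by have := sum_powR d p01; rewrite div1r.
have -> : \sum_(k < d) v k - k0 * (d%:R `^ p / p) =
  (\sum_(k < d) v k - k0 * \sum_(k < d) s k) +
  k0 * (\sum_(k < d) s k - d%:R `^ p / p) by ring.
apply: le_trans (ler_normD _ _) _.
have C1d : C1 <= ka / 2 * d%:R `^ p.
  rewrite -ler_pdivrMl ?divr_gt0//.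
  by near: d; exact: nearn_powR_ge.
have := ler_wpM2l (ltW ka10) sd.
have -> : ka1 * (d%:R `^ p / p + 1 / p) = ka / 2 * d%:R `^ p + ka1 / p.
  by rewrite /ka1; field; rewrite gt_eqF.
by move: C1d; rewrite /C1; lra.
Unshelve. all: by end_near. Qed.

(** The logarithmic deviation of the semi-axis of index [n = k + 1] from [c n^(-a)]. *)
Definition log_ratio (R : realType) (mu : nat -> R) (a c : R) (k : nat) : R :=
  ln (mu k * k.+1%:R `^ a / c).

(** Here [mu_n n^a1 / c1 = 1 + t] with [t = (c2 / c1) s + o(s)] and [s = n^(a1 - a2)]. Since [s]
    tends to 0, the error [2 t^2] of [ln (1 + t)] is o(s). *)
Lemma log_ratio_asympt (R : realType) (mu : nat -> R) (a1 a2 c1 c2 : R) :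
  a1 < a2 -> 0 < c1 ->
  mu = (fun k : nat => c1 / k.+1%:R `^ a1 + c2 / k.+1%:R `^ a2)
     +o_\oo (fun k : nat => 1 / k.+1%:R `^ a2) ->
  forall ka, 0 < ka -> \forall k \near \oo,
    `|log_ratio mu a1 c1 k - c2 / c1 * k.+1%:R `^ (a1 - a2)|
      <= ka * k.+1%:R `^ (a1 - a2).
Proof.
move=> a12 c10 /eqaddoP mu_o ka ka0.
pose Q : R := `|c2 / c1| + ka / 2.
have Q0 : 0 < Q by rewrite ltr_wpDl// divr_gt0.
have eta0 : 0 < ka * c1 / 2 by rewrite divr_gt0// mulr_gt0.
have a21 : 0 < a2 - a1 by rewrite subr_gt0.
near=> k.
set n : R := k.+1%:R; have n0 : 0 < n by rewrite /n ltr0n.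
set s := n `^ (a1 - a2); have s0 : 0 < s by exact: powR_gt0.
have sV : s = (n `^ (a2 - a1))^-1 by rewrite /s -powRN opprB.
have n1 : 0 < n `^ a1 by exact: powR_gt0.
have n2 : 0 < n `^ a2 by exact: powR_gt0.
have snn : s = n `^ a1 / n `^ a2 by rewrite /s powRB// (gt_eqF n0) implybT.
have muk : `|mu k - (c1 / n `^ a1 + c2 / n `^ a2)| <= ka * c1 / 2 * (n `^ a2)^-1.
  have : `|(mu - (fun k : nat => c1 / k.+1%:R `^ a1 + c2 / k.+1%:R `^ a2)) k| <=
      ka * c1 / 2 * `|1 / k.+1%:R `^ a2| by near: k; exact: mu_o.
  by rewrite -/n div1r (gtr0_norm (_ : 0 < (n `^ a2)^-1)) ?invr_gt0.
pose t := mu k * n `^ a1 / c1 - 1.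
have ht : `|t - c2 / c1 * s| <= ka / 2 * s.
  have -> : t - c2 / c1 * s = (mu k - (c1 / n `^ a1 + c2 / n `^ a2)) * (n `^ a1 / c1).
    by rewrite /t snn; field; rewrite !gt_eqF.
  rewrite normrM (gtr0_norm (divr_gt0 n1 c10)).
  apply: le_trans (ler_wpM2r (ltW (divr_gt0 n1 c10)) muk) _.
  by rewrite snn le_eqVlt; apply/orP; left; apply/eqP; field; rewrite !gt_eqF.
(* The two thresholds give [|t| <= Q s <= 1 / 2] and [2 t^2 <= ka s / 2]. *)
have big : Num.max (2 * Q) (4 * Q ^+ 2 / ka) <= n `^ (a2 - a1).
  apply: (@le_trans _ _ (k%:R `^ (a2 - a1))).
    by near: k; exact: nearn_powR_ge.
  by apply: ge0_ler_powR; rewrite ?nnegrE ?ler_nat// ltW.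
have tQ : `|t| <= Q * s.
  have -> : t = (t - c2 / c1 * s) + c2 / c1 * s by rewrite subrK.
  apply: le_trans (ler_normD _ _) _; rewrite /Q mulrDl addrC lerD//.
  by rewrite normrM (gtr0_norm s0).
have [b1 b2] : 2 * Q * s <= 1 /\ 4 * Q ^+ 2 * s <= ka.
  move: big; rewrite ge_max sV => /andP[b1 b2].
  have nn : 0 < n `^ (a2 - a1) by exact: powR_gt0.
  split; first by rewrite ler_pdivrMr// mul1r.
  by rewrite ler_pdivrMr// [ka * _]mulrC -ler_pdivrMr.
have t12 : `|t| <= 1 / 2 by lra.
have := ln1D_approx t12; have -> : 1 + t = mu k * n `^ a1 / c1 by rewrite /t subrKC.
rewrite -/(log_ratio mu a1 c1 k) => hl.
have -> : log_ratio mu a1 c1 k - c2 / c1 * s =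
  (log_ratio mu a1 c1 k - t) + (t - c2 / c1 * s) by ring.
apply: le_trans (ler_normD _ _) _.
have t2 : 2 * t ^+ 2 <= ka / 2 * s.
  have : t ^+ 2 <= (Q * s) ^+ 2.
    by rewrite -(real_normK (num_real t)) lerXn2r// nnegrE mulr_ge0// ltW.
  have := ler_wpM2r (ltW s0) b2; rewrite exprMn !expr2; lra.
by lra.
Unshelve. all: by end_near. Qed.

(** Termwise, [ln (mu_n / e)] is the logarithmic deviation plus [a1 (ln x - ln n)]. *)
Lemma sum_ln_ratio (R : realType) (mu : nat -> R) (a1 c1 e x : R) (d : nat) :
  (forall k, 0 < mu k) -> 0 < c1 -> 0 < x -> e = c1 / x `^ a1 ->
  \sum_(k < d) ln (mu k / e) =
  \sum_(k < d) log_ratio mu a1 c1 k + a1 * (d%:R * ln x - lnfact R d).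
Proof.
move=> mu0 c10 x0 ->.
have -> : a1 * (d%:R * ln x - lnfact R d) = \sum_(k < d) a1 * (ln x - ln k.+1%:R).
  by rewrite -mulr_sumr sumrB sumr_const card_ord mulr_natl.
rewrite -big_split/=; apply: eq_bigr => k _; rewrite /log_ratio.
have n0 : 0 < k.+1%:R :> R by rewrite ltr0n.
have xa := powR_gt0 a1 x0; have na := powR_gt0 a1 n0.
rewrite mulrBr -!ln_powR addrA [_ + ln (x `^ a1)]addrC.
rewrite !ln_div ?lnM ?posrE ?divr_gt0 ?mulr_gt0//.
by ring.
Qed.

(** * Entropy bounds in the variable x *)

Lemma powR_near_le (R : realType) (y z p : R) : 0 < p <= 1 -> 1 <= y -> y <= z ->
  z <= y + 1 -> y `^ p <= z `^ p <= y `^ p + 1.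
Proof.
move=> p01 y1 yz zy; have /andP[p0 p1] := p01.
have y0 : 0 < y by apply: lt_le_trans y1.
have z0 : 0 < z by apply: lt_le_trans yz.
rewrite ge0_ler_powR ?nnegrE ?(ltW y0) ?(ltW z0) ?(ltW p0)//=.
apply: (@le_trans _ _ ((y + 1) `^ p)).
  by apply: ge0_ler_powR; rewrite ?nnegrE ?(ltW z0) ?(ltW p0)// addr_ge0// ltW.
have := powR_increment_le y0 p01; rewrite powR_sub1//.
have yp : y `^ p <= y.
  by rewrite -[leRHS](powRr1 (ltW y0)) ler_powR.
have : p * (y `^ p / y) <= 1 * 1.
  by rewrite ler_pM ?(ltW p0)// ?divr_ge0 ?powR_ge0 ?(ltW y0)// ler_pdivrMr// mul1r.
by lra.
Qed.

(** The lower bound is available for every dimension from 36 on, so [d] is taken to be the integer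
    part of [x]; only the upper bound has to locate the semi-axes larger than the radius. *)
Lemma entropy_lower_asympt (R : realType) (mu : nat -> R) (a1 c1 k0 p : R) :
  (forall k, 0 < mu k) -> (exists B, forall k, mu k <= B) ->
  0 < a1 -> 0 < c1 -> 1 / 2 < p <= 1 ->
  (forall ka, 0 < ka -> \forall d \near \oo,
    `|\sum_(k < d) log_ratio mu a1 c1 k - k0 * (d%:R `^ p / p)| <= ka * d%:R `^ p) ->
  forall ka, 0 < ka -> \forall x \near +oo, forall N A, (A #= `I_N)%card ->
    is_covering (c1 / x `^ a1) (ellipsoid2 mu) A ->
    (0 < N)%N /\ a1 * x + k0 * (x `^ p / p) - ka * x `^ p <= ln N%:R.
Proof.
move=> mu0 muB a10 c10 /andP[p12 p1] VP ka ka0.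
have p0 : 0 < p by lra.
have p01 : 0 < p <= 1 by rewrite p0.
have ka20 : 0 < ka / 2 by rewrite divr_gt0.
have [n0 _ n0P] := VP _ ka20.
(* The summands pay for the Stirling error, for replacing [d^p] by [x^p], and for the terms
   [12 sqrt d] and [ln 2] of the covering bound. *)
pose C : R := 2 * a1 + `|k0| / p + 12 + ln 2.
near=> x => N A AN cov.
have xn0 : n0%:R <= x by near: x; apply: nbhs_pinfty_ge; exact: num_real.
have x36 : 36 <= x by near: x; apply: nbhs_pinfty_ge; exact: num_real.
have err : C * ((1 + ln x) * Num.sqrt x) <= ka / 2 * x `^ p.
  by near: x; exact: near_log_sqrt_le.
have x0 : 0 < x by lra.
pose d := Num.truncn x; have /andP[dx xd] := truncn_itv (ltW x0).
have dn0 : (n0 <= d)%N by rewrite truncn_ge_nat// ltW.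
have d36 : (36 <= d)%N by rewrite truncn_ge_nat// ltW.
have d0 : 0 < d%:R :> R by rewrite ltr0n (leq_trans _ d36).
have d1 : 1 <= d%:R :> R by rewrite ler1n (leq_trans _ d36).
have e0 : 0 < c1 / x `^ a1 by rewrite divr_gt0// powR_gt0.
have [N0 lnN] := ellipsoid_covering_lower mu0 muB e0 d36 AN cov.
split=> //; apply: le_trans lnN.
rewrite (sum_ln_ratio d mu0 c10 x0 erefl).
have {n0P}/ler_normlP[V1 V2] := n0P d dn0.
have xd1 : x <= d%:R + 1 by rewrite natr1 ltW.
have /andP[dp1 dp2] := powR_near_le p01 d1 dx xd1.
have hk : k0 * (x `^ p / p) - k0 * (d%:R `^ p / p) <= `|k0| / p.
  rewrite -mulrBr -mulrBl mulrA ler_pM2r ?invr_gt0//.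
  apply: le_trans (ler_norm _) _; rewrite normrM ler_piMr//.
  by rewrite ger0_norm; move: dp1 dp2; clear; lra.
have lndx : ln d%:R <= ln x by rewrite ler_ln.
have hF : x - 2 - ln x <= d%:R * ln x - lnfact R d.
  have := @lnfact_upper R d; rewrite (leq_trans _ d36)// => /(_ isT).
  have := ler_wpM2l (ltW d0) lndx; lra.
have hF2 := ler_wpM2l (ltW a10) hF.
have sq : Num.sqrt d%:R <= Num.sqrt x by rewrite ler_wsqrtr.
have sx1 : 1 <= Num.sqrt x by rewrite -[leLHS]sqrtr1 ler_wsqrtr//; lra.
have lx0 : 0 <= ln x by rewrite ln_ge0//; lra.
have kp0 : 0 <= `|k0| / p by rewrite divr_ge0// ltW.
have ln20 : 0 <= ln 2 :> R by rewrite ln_ge0// ler1n.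
have e1 : 1 + ln x <= (1 + ln x) * Num.sqrt x by rewrite ler_peMr// addr_ge0.
have e2 : Num.sqrt x <= (1 + ln x) * Num.sqrt x by rewrite ler_peMl ?sqrtr_ge0// lerDl.
have e3 := ler_wpM2l (ltW a10) e1.
have e4 : `|k0| / p + ln 2 <= (`|k0| / p + ln 2) * ((1 + ln x) * Num.sqrt x).
  by rewrite ler_peMr ?addr_ge0//; move: e1 lx0; clear; lra.
have kd : ka / 2 * d%:R `^ p <= ka / 2 * x `^ p by rewrite ler_pM2l.
have al : 0 <= a1 * ln x by rewrite mulr_ge0// ltW.
move: err V1 V2 hk hF2 sq e1 e2 e3 e4 kd al; rewrite /C; clear.
move: (\sum_(k < d) log_ratio mu a1 c1 k) (lnfact R d) => V F.
by move: (d%:R * ln x) (d%:R `^ p) (x `^ p) => DL DP XP; lra.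
Unshelve. all: by end_near. Qed.

(** The logarithm of what the covering bound carries beyond the product of the [mu k / e]; [ln 2]
    absorbs its trailing [+ 1]. *)
Definition covering_excess (R : realType) (B e : R) (d J : nat) : R :=
  J%:R * ln (J%:R ^+ 2 + 1) + ln 2 + ln (d%:R * (4 * B * J%:R * d%:R / e + 3))
  + d%:R / J%:R / 2 + (1 + ln (36 * J%:R ^+ 4)) * Num.sqrt d%:R
  + ln (24 * J%:R ^+ 4).

Lemma ellipsoid_covering_upper_ln (R : realType) (mu : nat -> R) (e B : R) (d J : nat) :
  (forall k, 0 < mu k) -> (forall k, mu k <= B) -> 0 < e -> (0 < d)%N -> (0 < J)%N ->
  (forall k, (k < d)%N -> e < mu k) -> (forall k, (d <= k)%N -> mu k <= e) ->
  exists N A, [/\ (A #= `I_N)%card,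
    is_covering (e * (1 + J%:R^-1) ^+ 3) (ellipsoid2 mu) A &
    (0 < N)%N -> ln N%:R <= \sum_(k < d) ln (mu k / e) + covering_excess B e d J].
Proof.
move=> mu0 muB e0 d0 J0 mud mud'.
have [N [A [AN Acov hN]]] := ellipsoid_covering_upper mu0 muB e0 d0 J0 mud mud'.
exists N, A; split => // N0.
have J0' : 0 < J%:R :> R by rewrite ltr0n.
have B0 : 0 <= B by apply: le_trans (ltW (mu0 0%N)) (muB _).
have /andP[s0 s1] := @slack_factor_itv R d J J0.
set V := d%:R * _ in hN.
have V1 : 1 <= V.
  rewrite mulr_ege1 ?ler1n//.
  have : 0 <= 4 * B * J%:R * d%:R / e by rewrite divr_ge0 ?(ltW e0)// !mulr_ge0.
  by lra.
have V0 : 0 < V by apply: lt_le_trans V1.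
pose P := \prod_(n < d) (e / mu n).
have P0 : 0 < P by apply: prodr_gt0 => n _; rewrite divr_gt0.
have P1 : P <= 1.
  apply: prodr_ile1 => n _; rewrite divr_ge0 ?(ltW e0) ?(ltW (mu0 _))//=.
  by rewrite ler_pdivrMr// mul1r ltW// mud.
have q0 : 0 < P * slack_factor R d J by rewrite mulr_gt0.
have V2 : 1 <= V / (P * slack_factor R d J).
  rewrite ler_pdivlMr// mul1r; apply: le_trans V1.
  by rewrite mulr_ile1// ltW.
have K10 : 0 < J%:R ^+ 2 + 1 :> R by rewrite ltr_wpDl// sqr_ge0.
have {}hN : N%:R <= (J%:R ^+ 2 + 1) ^+ J * (2 * V / (P * slack_factor R d J)).
  apply: le_trans hN _; rewrite ler_pM2l ?exprn_gt0//.
  by rewrite -/P -mulrA; lra.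
have : ln N%:R <= ln ((J%:R ^+ 2 + 1) ^+ J * (2 * V / (P * slack_factor R d J))).
  rewrite ler_ln ?posrE ?ltr0n//; apply: mulr_gt0; first exact: exprn_gt0.
  by rewrite divr_gt0// mulr_gt0.
move/le_trans; apply.
have -> : ln ((J%:R ^+ 2 + 1) ^+ J * (2 * V / (P * slack_factor R d J))) =
    J%:R * ln (J%:R ^+ 2 + 1) + (ln 2 + ln V - (ln P + ln (slack_factor R d J))).
  rewrite [J%:R * _]mulr_natl -lnXn// -(lnM (x := P)) ?posrE// -(lnM (x := 2)) ?posrE//.
  have V20 : 0 < 2 * V by exact: mulr_gt0.
  rewrite -ln_div ?posrE// -lnM ?posrE ?exprn_gt0//.
  exact: divr_gt0.
have -> : ln P = - \sum_(k < d) ln (mu k / e).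
  rewrite /P (sum_ln_prod d (u := fun n => e / mu n)); last by move=> k; rewrite divr_gt0.
  rewrite -sumrN; apply: eq_bigr => k _.
  rewrite -(invf_div (mu k) e) lnV ?posrE ?divr_gt0//.
have -> : ln (slack_factor R d J) = - (d%:R / J%:R / 2) -
    (1 + ln (36 * J%:R ^+ 4)) * Num.sqrt d%:R - ln (24 * J%:R ^+ 4).
  by rewrite ln_div ?posrE ?expR_gt0 ?mulr_gt0 ?exprn_gt0// expRK.
rewrite /covering_excess -/V; lra.
Qed.

(** With [J] of order sqrt x, both [J ln J] and [d / J] are O(sqrt x ln x), and the remaining
    logarithms are O(ln x). *)
Lemma covering_excess_le (R : realType) (B a1 c1 : R) : 0 <= B -> 0 < a1 -> 0 < c1 ->
  exists C, forall (x e : R) (d J : nat), 4 <= x -> c1 / (8 * x `^ a1) <= e ->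
    (0 < d)%N -> d%:R <= 2 * x -> Num.sqrt x <= J%:R -> J%:R <= Num.sqrt x + 1 ->
    covering_excess B e d J <= C * ((1 + ln x) * Num.sqrt x).
Proof.
move=> B0 a10 c10.
(* From [d, J <= 2 x] and [1 / e <= 8 x^a1 / c1]: the argument of the third logarithm is at most
   [C2 x^(3 + a1)]. *)
pose C2 : R := 2 * (128 * B / c1 + 3).
exists (10 + ln 2 + `|ln C2| + (3 + a1) + 1 + 2 * (1 + (ln 36 + ln 16) + 2) + (ln 24 + ln 16) + 2).
move=> x e d J x4 xe d0 dx Jx xJ.
set l := ln x; set q := Num.sqrt x.
have x0 : 0 < x by lra.
have q0 : 0 <= q by exact: sqrtr_ge0.
have q2 : q ^+ 2 = x by rewrite sqr_sqrtr// ltW.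
have qq : 2 <= q by rewrite leNgt; apply/negP => q2'; nra.
have l0 : 0 <= l by rewrite ln_ge0//; lra.
have xa0 : 0 < x `^ a1 by exact: powR_gt0.
have e0 : 0 < e by apply: lt_le_trans xe; rewrite divr_gt0// mulr_gt0.
have J0 : 0 < J%:R :> R by rewrite -/q in Jx; lra.
have d0' : 0 < d%:R :> R by rewrite ltr0n.
have J2q : J%:R <= 2 * q by rewrite -/q in xJ; lra.
have J24 : J%:R ^+ 2 <= 4 * x by rewrite -q2; nra.
have J416 : J%:R ^+ 4 <= 16 * x ^+ 2.
  have -> : J%:R ^+ 4 = (J%:R ^+ 2) ^+ 2 :> R by rewrite -exprM.
  have -> : 16 * x ^+ 2 = (4 * x) ^+ 2 by ring.
  by rewrite lerXn2r// nnegrE ?sqr_ge0// mulr_ge0// ltW.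
have lnle (u z : R) (n : nat) : 0 < u -> 0 < z -> u <= z * x ^+ n -> ln u <= ln z + n%:R * l.
  move=> u0 z0 uz; rewrite [n%:R * _]mulr_natl -lnXn// -lnM ?posrE ?exprn_gt0//.
  by rewrite ler_ln// posrE mulr_gt0// exprn_gt0.
have h1 : J%:R * ln (J%:R ^+ 2 + 1) <= 10 * ((1 + l) * q).
  have : ln (J%:R ^+ 2 + 1) <= ln 5 + 1%:R * l.
    by apply: lnle => //; rewrite expr1; lra.
  have : ln 5 < 5 :> R by rewrite ln_sublinear.
  move=> l5 hl; have {}hl : ln (J%:R ^+ 2 + 1) <= 5 * (1 + l) by lra.
  apply: le_trans (ler_wpM2l (ltW J0) hl) _.
  apply: le_trans (ler_wpM2r _ J2q) _; first by rewrite mulr_ge0// addr_ge0.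
  lra.
have h2 : ln (d%:R * (4 * B * J%:R * d%:R / e + 3)) <= ln C2 + (3 + a1) * l.
  have C20 : 0 < C2.
    apply: mulr_gt0 => //; apply: ltr_wpDl => //.
    by rewrite divr_ge0 ?(ltW c10)// mulr_ge0.
  have -> : (3 + a1) * l = ln (x ^+ 3 * x `^ a1).
    by rewrite lnM ?posrE ?exprn_gt0// lnXn// ln_powR -/l -[l *+ 3]mulr_natl mulrDl.
  have in0 : 0 < 4 * B * J%:R * d%:R / e + 3.
    by rewrite ltr_wpDl// divr_ge0 ?(ltW e0)// !mulr_ge0.
  have X0 : 0 < x ^+ 3 * x `^ a1 by rewrite mulr_gt0// exprn_gt0.
  have L0 := mulr_gt0 d0' in0; have R0 := mulr_gt0 C20 X0.
  rewrite -lnM ?posrE// ler_ln ?posrE//.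
  have ie : e^-1 <= 8 * x `^ a1 / c1.
    by rewrite -[leRHS]invrK lef_pV2 ?posrE ?invr_gt0 ?divr_gt0 ?mulr_gt0// invf_div.
  have Jx' : J%:R <= 2 * x by nra.
  have k1 : 4 * B * J%:R * d%:R / e <= 4 * B * (2 * x) * (2 * x) * (8 * x `^ a1 / c1).
    apply: ler_pM => //; first by rewrite !mulr_ge0.
      by rewrite invr_ge0 ltW.
    apply: ler_pM => //; first by rewrite !mulr_ge0.
    by apply: ler_wpM2l => //; rewrite mulr_ge0.
  have k2 : 3 <= 3 * x ^+ 2 * x `^ a1.
    have xa1 : 1 <= x `^ a1.
      have E1 : 1 `^ a1 = 1 :> R by rewrite powR1.
      rewrite -[leLHS]E1; apply: ge0_ler_powR; rewrite ?nnegrE ?(ltW a10) ?(ltW x0)//; lra.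
    by rewrite -mulrA ler_peMr// mulr_ege1// exprn_ege1//; lra.
  apply: (@le_trans _ _ (2 * x * (4 * B * (2 * x) * (2 * x) * (8 * x `^ a1 / c1) +
      3 * x ^+ 2 * x `^ a1))).
    by rewrite ler_pM// ?(ltW in0)// lerD.
  rewrite le_eqVlt; apply/orP; left; apply/eqP; rewrite /C2; field.
  by rewrite gt_eqF.
have h3 : d%:R / J%:R / 2 <= q.
  have qJ : q * q <= q * J%:R by rewrite ler_wpM2l.
  have qqx : q * q = x by rewrite -expr2.
  rewrite !ler_pdivrMr//; lra.
have lnJ (c : R) : 0 < c -> ln (c * J%:R ^+ 4) <= ln c + ln 16 + 2%:R * l.
  move=> cpos; rewrite lnM ?posrE ?exprn_gt0// -addrA lerD2l.
  by apply: lnle => //; exact: exprn_gt0.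
have h4 : (1 + ln (36 * J%:R ^+ 4)) * Num.sqrt d%:R <=
    (1 + (ln 36 + ln 16) + 2 * l) * (2 * q).
  have J41 : 1 <= J%:R ^+ 4 :> R by rewrite exprn_ege1// ler1n -(ltr0n R).
  have J36 : 1 <= 36 * J%:R ^+ 4 :> R by rewrite mulr_ege1// ler1n.
  have sd : Num.sqrt d%:R <= 2 * q.
    apply: (@le_trans _ _ (Num.sqrt (2 ^+ 2 * x))).
      by rewrite ler_wsqrtr//; lra.
    by rewrite sqrtrM ?sqr_ge0// sqrtr_sqr ger0_norm.
  apply: ler_pM => //.
    by rewrite addr_ge0// ln_ge0.
  by rewrite -[leRHS]addrA lerD2l lnJ.
have h5 : ln (24 * J%:R ^+ 4) <= ln 24 + ln 16 + 2%:R * l by exact: lnJ.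
set E := (1 + l) * q.
have E1 : 1 <= E by rewrite mulr_ege1//; move: l0 qq; clear; lra.
have El : l <= E by rewrite /E; nra.
have Eq : q <= E by rewrite /E; nra.
have ln2 : 0 <= ln 2 :> R by rewrite ln_ge0// ler1n.
have ln3616 : 0 <= ln 36 + ln 16 :> R by rewrite addr_ge0// ln_ge0// ler1n.
have ln2416 : 0 <= ln 24 + ln 16 :> R by rewrite addr_ge0// ln_ge0// ler1n.
have m1 : ln 2 <= ln 2 * E by rewrite ler_peMr.
have m2 : ln C2 <= `|ln C2| * E by rewrite (le_trans (ler_norm _))// ler_peMr.
have m3 : (3 + a1) * l <= (3 + a1) * E by rewrite ler_wpM2l// addr_ge0// ltW.
have m4 : ln 24 + ln 16 <= (ln 24 + ln 16) * E by rewrite ler_peMr.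
have m5 : (1 + (ln 36 + ln 16)) * q <= (1 + (ln 36 + ln 16)) * E.
  by rewrite ler_wpM2l// addr_ge0.
have m6 : l * q <= E by rewrite /E mulrDl mul1r lerDr.
move: h1 h2 h3 h4 h5 m1 m2 m3 m4 m5 m6 El Eq; clear; rewrite /covering_excess.
move: (ln 36 + ln 16) (ln 24 + ln 16) (ln 2) `|ln C2| (ln C2) => u1 u2 u3 u4 u5.
move: (_ * ln (J%:R ^+ 2 + 1)) (ln (d%:R * _)) (d%:R / J%:R / 2)
  (_ * Num.sqrt d%:R) (ln (24 * _)) => w1 w2 w3 w4 w5.
rewrite -/E; move: E => E; lra.
Qed.

Lemma log_ratioE (R : realType) (mu : nat -> R) (a c : R) (k : nat) :
  0 < mu k -> 0 < c ->
  log_ratio mu a c k = ln (mu k) + a * ln k.+1%:R - ln c.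
Proof.
move=> m0 c0; have n0 : 0 < k.+1%:R `^ a :> R by rewrite powR_gt0// ltr0n.
by rewrite /log_ratio ln_div ?posrE ?mulr_gt0// lnM ?posrE// ln_powR.
Qed.

Lemma expR_le1D2x (R : realType) (t : R) : 0 <= t <= 1 / 2 -> expR t <= 1 + 2 * t.
Proof.
move=> /andP[t0 t1]; rewrite -[expR t]invrK -expRN.
have h : 1 - t <= expR (- t) by exact: expR_ge1Dx.
apply: (@le_trans _ _ (1 - t)^-1).
  by rewrite lef_pV2 ?posrE ?expR_gt0//; lra.
rewrite -div1r ler_pdivrMr; last by lra.
have : 0 <= t * (1 - 2 * t) by rewrite mulr_ge0//; lra.
by lra.
Qed.

(** A bounded logarithmic deviation forces [ln (mu k) <= 1 + ln c1 - a1 ln (k + 1)], which tends to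
    [-oo]. *)
Lemma exists_semiaxis_le (R : realType) (mu : nat -> R) (a1 c1 e : R) :
  (forall k, 0 < mu k) -> 0 < a1 -> 0 < c1 -> 0 < e ->
  (\forall k \near \oo, `|log_ratio mu a1 c1 k| <= 1) -> exists k, mu k <= e.
Proof.
move=> mu0 a10 c10 e0 v1.
near \oo => k; exists k.
have : `|log_ratio mu a1 c1 k| <= 1 by near: k.
rewrite log_ratioE// => /ler_normlP[_ h].
have kb : expR ((1 + ln c1 - ln e) / a1) <= k%:R.
  by near: k; exact: nbhs_infty_ger.
have hk : (1 + ln c1 - ln e) / a1 <= ln k.+1%:R.
  rewrite -[leLHS]expRK ler_ln ?posrE ?expR_gt0 ?ltr0n//.
  by apply: le_trans kb _; rewrite ler_nat.
rewrite -ler_ln ?posrE//; move: hk; rewrite ler_pdivrMr// mulrC; lra.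
Unshelve. all: by end_near. Qed.

(** The covering is built at a radius [e1] smaller by the factor [(1 + 1 / J)^3]. In terms of [x]
    this costs O(x / J), that is O(sqrt x), and the number [d] of semi-axes above [e1] satisfies
    [d^p = x^p (1 + o(1))]. *)
Lemma entropy_upper_asympt (R : realType) (mu : nat -> R) (a1 c1 k0 p : R) :
  (forall k, 0 < mu k) -> nonincreasing_seq mu ->
  0 < a1 -> 0 < c1 -> 1 / 2 < p <= 1 ->
  (forall ka, 0 < ka -> \forall k \near \oo, `|log_ratio mu a1 c1 k| <= ka) ->
  (forall ka, 0 < ka -> \forall d \near \oo,
    `|\sum_(k < d) log_ratio mu a1 c1 k - k0 * (d%:R `^ p / p)| <= ka * d%:R `^ p) ->
  forall ka, 0 < ka -> \forall x \near +oo, exists N A, [/\ (A #= `I_N)%card,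
    is_covering (c1 / x `^ a1) (ellipsoid2 mu) A &
    (0 < N)%N -> ln N%:R <= a1 * x + k0 * (x `^ p / p) + ka * x `^ p].
Proof.
move=> mu0 mu_noninc a10 c10 /andP[p12 p1] vP VP ka ka0.
have p0 : 0 < p by lra.
have p01 : 0 < p <= 1 by rewrite p0.
have muB k : mu k <= mu 0%N by exact: mu_noninc.
have B0 : 0 <= mu 0%N by exact: ltW.
pose Kp := `|k0| / p.
have Kp0 : 0 <= Kp by rewrite divr_ge0// ltW.
pose ka1 := ka / (4 * (Kp + 1)).
have ka10 : 0 < ka1 by rewrite divr_gt0// mulr_gt0// ltr_wpDl.
have Kpka1 : Kp * ka1 <= ka / 4.
  have -> : ka / 4 = (Kp + 1) * ka1 by rewrite /ka1; field; rewrite gt_eqF// ltr_wpDl.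
  by rewrite ler_pM2r// lerDl.
(* [rho] bounds the error on [ln d]: the first bound gives [d <= 2 x], the second
   [exp rho <= 1 + ka1]. *)
pose rho := Num.min (1 / 4) (ka1 / 2).
have rho0 : 0 < rho by rewrite lt_min divr_gt0//= divr_gt0.
have rho4 : rho <= 1 / 4 by rewrite ge_min lexx.
have rhok : rho <= ka1 / 2 by rewrite ge_min lexx orbT.
have ka8 : 0 < ka / 8 by rewrite divr_gt0.
have [n1 _ n1P] := VP _ ka8.
have eta0 : 0 < a1 * rho / 2 by rewrite divr_gt0// mulr_gt0.
have [n2 _ n2P] := vP _ eta0.
pose n0 := maxn n1 n2.
have [C CP] := covering_excess_le B0 a10 c10.
near=> x.
have x4 : 4 <= x by near: x; apply: nbhs_pinfty_ge; exact: num_real.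
have x0 : 0 < x by lra.
have err : (Kp + 6 + C) * ((1 + ln x) * Num.sqrt x) <= ka / 2 * x `^ p.
  by near: x; apply: near_log_sqrt_le => //; rewrite divr_gt0.
have xn0 : c1 / mu n0 + 1 <= x `^ a1 by near: x; exact: near_powR_ge.
have xJ : 6 / (a1 * rho) <= Num.sqrt x.
  have : 6 / (a1 * rho) <= x `^ 2^-1 by near: x; exact: near_powR_ge.
  by rewrite powR12_sqrt// ltW.
set q := Num.sqrt x in xJ err *.
have q0 : 0 <= q by exact: sqrtr_ge0.
have q2 : q ^+ 2 = x by rewrite sqr_sqrtr// ltW.
pose J := (Num.truncn q).+1.
have /andP[Jq qJ] := truncn_itv q0.
have qJ' : q <= J%:R by exact: ltW.
have Jq' : J%:R <= q + 1 by rewrite /J -natr1 lerD2r.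
have J0 : 0 < J%:R :> R by rewrite ltr0n.
have J1 : 1 <= J%:R :> R by rewrite ler1n.
pose u := J%:R^-1 : R.
have u0 : 0 < u by rewrite invr_gt0.
have u1 : u <= 1 by rewrite invf_le1.
have ulim : 3 / a1 * u <= rho / 2.
  rewrite /u ler_pdivrMr//.
  have : 6 / (a1 * rho) <= J%:R by apply: le_trans qJ'.
  rewrite ler_pdivrMr ?mulr_gt0// => h.
  rewrite ler_pdivrMr//; move: h; clear; lra.
(* Chosen so that [c1 / x1^a1], inflated by [(1 + u)^3], is exactly the prescribed radius. *)
pose x1 := x * (1 + u) `^ (3 / a1).
have uu : 0 < 1 + u by rewrite addr_gt0.
have x10 : 0 < x1 by rewrite mulr_gt0// powR_gt0.
have x1a : x1 `^ a1 = x `^ a1 * (1 + u) ^+ 3.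
  rewrite powRM ?powR_ge0 ?(ltW x0)// -powRrM divfK ?gt_eqF//.
  by rewrite powR_mulrn// ltW.
have xa0 : 0 < x `^ a1 by exact: powR_gt0.
pose e1 := c1 / x1 `^ a1.
have e10 : 0 < e1 by rewrite divr_gt0// powR_gt0.
have e1E : e1 * (1 + u) ^+ 3 = c1 / x `^ a1.
  by rewrite /e1 x1a; field; rewrite !gt_eqF.
have lnx1 : ln x <= ln x1 <= ln x + rho / 2.
  rewrite lnM ?posrE ?powR_gt0// ln_powR lerDl lerD2l.
  rewrite mulr_ge0 ?ln_ge0 ?divr_ge0 ?(ltW a10) ?lerDl ?(ltW u0)//=.
  apply: le_trans ulim; apply: ler_wpM2l; first by rewrite divr_ge0// ltW.
  by apply: le_ln1Dx; move: u0; clear; lra.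
pose P k := mu k <= e1.
have exP : exists k, P k by apply: (exists_semiaxis_le mu0 a10 c10 e10); exact: vP.
(* Indices start at 0 and the semi-axes are non-increasing, so exactly the first [d] of them exceed
   [e1]. *)
case: (ex_minnP exP) => d; rewrite /P => mud dmin.
have mud' k : (d <= k)%N -> mu k <= e1.
  by move=> dk; apply: le_trans mud; exact: mu_noninc.
have mudl k : (k < d)%N -> e1 < mu k.
  by move=> kd; rewrite ltNge; apply/negP => /dmin; rewrite leqNgt kd.
have dn0 : (n0 < d)%N.
  rewrite ltnNge; apply/negP => /mud'; apply/negP; rewrite -ltNge.
  apply: (@le_lt_trans _ _ (c1 / x `^ a1)).
    by rewrite -e1E ler_peMr ?(ltW e10)// exprn_ege1// lerDl ltW.
  rewrite ltr_pdivrMr// mulrC -ltr_pdivrMr//.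
  by apply: lt_le_trans xn0; rewrite ltrDl.
have d0 : (0 < d)%N by exact: leq_ltn_trans dn0.
have d1 : 1 <= d%:R :> R by rewrite ler1n.
have d0' : 0 < d%:R :> R by rewrite ltr0n.
have lne1 : ln e1 = ln c1 - a1 * ln x1 by rewrite ln_div ?posrE ?powR_gt0// ln_powR.
(* The last semi-axis above [e1] sits at position [d.-1] and has index [d]; the first one not above
   it has index [d + 1], used for the lower bound on [ln (d + 1)]. *)
have lnd_le : ln d%:R <= ln x + rho.
  have dm : (d.-1 < d)%N by rewrite ltn_predL.
  have := n2P d.-1; rewrite /= -ltnS prednK// (leq_ltn_trans (leq_maxr n1 n2) dn0).
  move=> /(_ isT); rewrite log_ratioE// prednK// => /ler_normlP[_ h].
  have : ln e1 <= ln (mu d.-1) by rewrite ler_ln ?posrE//; exact: ltW (mudl _ dm).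
  rewrite lne1 => h2; have /andP[_ lx] := lnx1.
  have : a1 * ln d%:R <= a1 * (ln x + rho).
    have := ler_wpM2l (ltW a10) lx; move: h h2; clear; lra.
  by rewrite ler_pM2l.
have lnd_ge : ln x - rho <= ln (d%:R + 1).
  have := n2P d; rewrite /= (leq_trans (leq_maxr n1 n2) (ltnW dn0)) => /(_ isT).
  rewrite log_ratioE// -natr1 => /ler_normlP[h _].
  have : ln (mu d) <= ln e1 by rewrite ler_ln ?posrE.
  rewrite lne1 => h2; have /andP[lx _] := lnx1.
  have : a1 * (ln x - rho) <= a1 * ln (d%:R + 1).
    have := ler_wpM2l (ltW a10) lx; have := mulr_gt0 a10 rho0; move: h h2; clear; lra.
  by rewrite ler_pM2l.
have rho_exp (t : R) : 0 <= t <= 1 -> expR (t * rho) <= 1 + ka1.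
  move=> /andP[t0 t1]; have tr : t * rho <= rho by rewrite ler_piMl// ltW.
  have tr0 : 0 <= t * rho by rewrite mulr_ge0// ltW.
  apply: le_trans (expR_le1D2x _) _; move: tr tr0 rho4 rhok; clear; lra.
have d2x : d%:R <= 2 * x.
  rewrite -ler_ln ?posrE ?mulr_gt0//; apply: le_trans lnd_le _.
  rewrite lnM ?posrE// addrC lerD2r -ler_expR lnK ?posrE//.
  apply: le_trans (expR_le1D2x _) _; move: rho0 rho4; clear; lra.
have dp_le : d%:R `^ p <= x `^ p * (1 + ka1).
  rewrite /powR !gt_eqF//.
  apply: (@le_trans _ _ (expR (p * ln x + p * rho))).
    by rewrite ler_expR -mulrDr ler_pM2l.
  by rewrite expRD ler_pM2l ?expR_gt0// rho_exp// ltW.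
have dp_ge : x `^ p * (1 - ka1) - 1 <= d%:R `^ p.
  have dd : d%:R <= d%:R + 1 :> R by rewrite lerDl.
  have /andP[_ h] := powR_near_le p01 d1 dd (lexx _).
  rewrite lerBlDr; apply: le_trans h.
  have dp10 : 0 < d%:R + 1 :> R by rewrite addr_gt0.
  rewrite /powR !gt_eqF//.
  apply: (@le_trans _ _ (expR (p * ln x - p * rho))); last first.
    by rewrite ler_expR -mulrBr ler_pM2l.
  rewrite expRD ler_pM2l ?expR_gt0//; apply: le_trans (expR_ge1Dx _).
  have : p * rho <= rho by rewrite ler_piMl// ltW.
  by move: rhok ka10; clear; lra.
have dxp : `|d%:R `^ p - x `^ p| <= ka1 * x `^ p + 1.
  by rewrite ler_norml; apply/andP; split; move: dp_le dp_ge; clear; lra.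
have xe : c1 / (8 * x `^ a1) <= e1.
  rewrite /e1 x1a ler_pM2l// lef_pV2 ?posrE ?mulr_gt0 ?exprn_gt0//.
  rewrite mulrC ler_pM2r//.
  have -> : 8 = (1 + 1) ^+ 3 :> R by ring.
  by rewrite lerXn2r ?nnegrE ?(ltW uu)// lerD2l.
have [N [A [AN Acov lnN]]] := ellipsoid_covering_upper_ln mu0 muB e10 d0
  (ltn0Sn _ : (0 < J)%N) mudl mud'.
exists N, A; split; [exact: AN|by rewrite -e1E|move=> N0].
apply: le_trans (lnN N0) _.
rewrite (sum_ln_ratio d mu0 c10 x10 erefl).
have {CP}exc := CP x e1 d J x4 xe d0 d2x qJ' Jq'.
have /ler_normlP[_ V2] := n1P d (leq_trans (leq_maxl n1 n2) (ltnW dn0)).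
have hF := ler_wpM2l (ltW a10) (lnfact_lower d x10).
have x1_le : a1 * x1 <= a1 * x + 6 * q.
  have v0 : 0 <= 3 / a1 * u by rewrite mulr_ge0 ?divr_ge0 ?(ltW a10) ?(ltW u0).
  have lnu : ln (1 + u) <= u by apply: le_ln1Dx; apply: lt_trans u0; rewrite ltrN10.
  have pw : (1 + u) `^ (3 / a1) <= 1 + 2 * (3 / a1 * u).
    rewrite /powR gt_eqF//; apply: (@le_trans _ _ (expR (3 / a1 * u))).
      by rewrite ler_expR ler_wpM2l ?divr_ge0 ?(ltW a10).
    by apply: expR_le1D2x; rewrite v0; move: ulim rho4; clear; lra.
  have xu : x * u <= q by rewrite ler_pdivrMr// -q2 expr2 ler_wpM2l.
  have ax : 0 <= a1 * x by rewrite mulr_ge0// ltW.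
  rewrite /x1 [a1 * (x * _)]mulrA; apply: le_trans (ler_wpM2l ax pw) _.
  have -> : a1 * x * (1 + 2 * (3 / a1 * u)) = a1 * x + 6 * (x * u).
    by field; rewrite gt_eqF.
  by move: xu; clear; lra.
have hk : k0 * (d%:R `^ p / p) - k0 * (x `^ p / p) <= Kp * (ka1 * x `^ p + 1).
  have -> : k0 * (d%:R `^ p / p) - k0 * (x `^ p / p) =
    k0 / p * (d%:R `^ p - x `^ p) by ring.
  apply: le_trans (ler_norm _) _; rewrite normrM normrM normfV (gtr0_norm p0).
  exact: ler_wpM2l.
have xp0 : 0 <= x `^ p by exact: powR_ge0.
set E := (1 + ln x) * q in exc err.
have lx0 : 0 <= ln x by rewrite ln_ge0//; move: x4; clear; lra.
have q1 : 1 <= q by rewrite -[leLHS]sqrtr1 ler_wsqrtr//; move: x4; clear; lra.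
have E1 : 1 <= E by rewrite mulr_ege1// lerDl.
have qE : q <= E by rewrite ler_peMl// lerDl.
have m1 : Kp <= Kp * E by rewrite ler_peMr.
have m2 : Kp * (ka1 * x `^ p) <= ka / 4 * x `^ p by rewrite mulrA ler_wpM2r.
have m3 : ka / 8 * d%:R `^ p <= ka / 8 * (2 * x `^ p).
  apply: ler_wpM2l; first exact: ltW.
  apply: (@le_trans _ _ ((2 * x) `^ p)).
    by apply: ge0_ler_powR; rewrite ?nnegrE ?mulr_ge0 ?(ltW p0) ?(ltW x0).
  rewrite powRM ?(ltW x0)// ler_wpM2r//.
  by rewrite -[leRHS]powRr1// ler_powR// ler1n.
move: V2 hF exc x1_le hk err m1 m2 m3 qE; clear.
move: (\sum_(k < d) log_ratio mu a1 c1 k) (lnfact R d) (covering_excess _ _ _ _) => V F X.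
move: (d%:R * ln x1) (d%:R `^ p) (x `^ p) => DL DP XP.
lra.
Unshelve. all: by end_near. Qed.

Lemma log_ratio_to0 (R : realType) (mu : nat -> R) (a1 a2 c1 k0 : R) :
  a1 < a2 ->
  (forall ka, 0 < ka -> \forall k \near \oo,
    `|log_ratio mu a1 c1 k - k0 * k.+1%:R `^ (a1 - a2)|
      <= ka * k.+1%:R `^ (a1 - a2)) ->
  forall ka, 0 < ka -> \forall k \near \oo, `|log_ratio mu a1 c1 k| <= ka.
Proof.
move=> a12 vP ka ka0; have a21 : 0 < a2 - a1 by rewrite subr_gt0.
have k01 : 0 < `|k0| + 1 by rewrite ltr_wpDl.
near=> k.
have n0 : 0 < k.+1%:R :> R by rewrite ltr0n.
have big : (`|k0| + 1) / ka <= k.+1%:R `^ (a2 - a1).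
  apply: (@le_trans _ _ (k%:R `^ (a2 - a1))).
    by near: k; exact: nearn_powR_ge.
  by apply: ge0_ler_powR; rewrite ?nnegrE ?ler_nat// ltW.
have : `|log_ratio mu a1 c1 k - k0 * k.+1%:R `^ (a1 - a2)|
      <= 1 * k.+1%:R `^ (a1 - a2) by near: k; exact: vP.
set s := k.+1%:R `^ (a1 - a2) => h.
have s0 : 0 < s by exact: powR_gt0.
have ks : (`|k0| + 1) * s <= ka.
  have -> : s = (k.+1%:R `^ (a2 - a1))^-1 by rewrite /s -powRN opprB.
  by rewrite ler_pdivrMr ?powR_gt0// mulrC -ler_pdivrMr.
rewrite -(subrK (k0 * s) (log_ratio mu a1 c1 k)).
apply: le_trans (ler_normD _ _) _; rewrite normrM (gtr0_norm s0); lra.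
Unshelve. all: by end_near. Qed.

(** * Return from x to the radius *)

Lemma powR_div_rescale (R : realType) (c e r : R) : 0 < c -> 0 < e ->
  (c / e) `^ r = c `^ r * e `^ (- r).
Proof.
move=> c0 e0; rewrite powRM ?invr_ge0 ?ltW//.
by rewrite -[e^-1]powR_inv1 ?ltW// -powRrM mulN1r.
Qed.

Theorem theorem17 (R : realType) (a1 a2 c1 c2 : R) (mu : nat -> R)
  (a1_gt0 : 0 < a1) (a2_gt0 : 0 < a2)
  (a1_lt_a2 : a1 < a2) (a2_lt : a2 < a1 + 1 / 2)
  (c1_gt0 : 0 < c1)
  (mu_noninc : nonincreasing_seq mu)
  (mu_gt0 : forall k, 0 < mu k)
  (mu_asympt : mu = (fun k : nat => c1 / k.+1%:R `^ a1 + c2 / k.+1%:R `^ a2)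
     +o_\oo (fun k : nat => 1 / k.+1%:R `^ a2)) :
  (fun eps : R => fine (metric_entropy eps (ellipsoid2 mu))) =
  (fun eps : R =>
     a1 * c1 `^ (1 / a1) / ln 2 * eps `^ (- (1 / a1))
     + c2 * c1 `^ ((1 - a2) / a1) / (ln 2 * (a1 - a2 + 1))
       * eps `^ (- ((a1 - a2 + 1) / a1)))
  +o_ (0^'+) (fun eps : R => eps `^ (- ((a1 - a2 + 1) / a1))).
Proof.
apply/eqaddoP => ka ka0.
pose p := a1 - a2 + 1.
have p12 : 1 / 2 < p by rewrite /p; lra.
have p1 : p <= 1 by rewrite /p; lra.
have p0 : 0 < p by lra.
have p01 : 0 < p <= 1 by rewrite p0.
have p121 : 1 / 2 < p <= 1 by rewrite p12.
have pE : p - 1 = a1 - a2 by rewrite /p addrK.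
have vP := log_ratio_asympt a1_lt_a2 c1_gt0 mu_asympt.
have v0 := log_ratio_to0 a1_lt_a2 vP.
have VP := @sum_powR_littleo R (log_ratio mu a1 c1) (c2 / c1) p p01.
rewrite pE in VP; move: (VP vP) => {}VP.
have ln2 : 0 < ln 2 :> R by rewrite ln_gt0// ltr1n.
have cp0 : 0 < c1 `^ (p / a1) by exact: powR_gt0.
(* Makes [ka' x^p / ln 2] equal to [ka e^(- p / a1)]. *)
pose ka' := ka * ln 2 / c1 `^ (p / a1).
have ka'0 : 0 < ka' by rewrite divr_gt0// mulr_gt0.
have muB : exists B, forall k, mu k <= B by exists (mu 0%N) => k; exact: mu_noninc.
have lo := entropy_lower_asympt mu_gt0 muB a1_gt0 c1_gt0 p121 VP ka'0.
have up := entropy_upper_asympt mu_gt0 mu_noninc a1_gt0 c1_gt0 p121 v0 VP ka'0.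
have [M [_ MP]] := filterI lo up.
pose M' := `|M| + 1.
have M'0 : 0 < M' by rewrite ltr_wpDl.
near=> e.
have e0 : 0 < e by near: e; exact: nbhs_right_gt.
have eM : e < c1 / M' `^ a1.
  by near: e; apply: nbhs_right_lt; rewrite divr_gt0// powR_gt0.
pose x := (c1 / e) `^ (1 / a1).
have ce0 : 0 < c1 / e by rewrite divr_gt0.
have xa : x `^ a1 = c1 / e.
  by rewrite /x -powRrM div1r mulVf ?gt_eqF// powRr1// ltW.
have eE : c1 / x `^ a1 = e by rewrite xa invf_div mulrC divfK// gt_eqF.
have Mx : M < x.
  apply: (@lt_le_trans _ _ M'); first by rewrite (le_lt_trans (ler_norm M))// ltrDl.
  have -> : M' = (M' `^ a1) `^ (1 / a1).
    by rewrite -powRrM div1r divff ?gt_eqF// powRr1// ltW.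
  apply: ge0_ler_powR; rewrite ?nnegrE ?powR_ge0 ?(ltW ce0)//.
    by rewrite divr_ge0// ltW.
  by rewrite ler_pdivlMr// mulrC -ler_pdivlMr ?powR_gt0// ltW.
have [] := MP _ Mx; rewrite eE => {}lo [N [A [AN Acov Nle]]].
have finA : finite_set A by exists N.
(* The lower bound is applied to an optimal covering [A']; minimality of [n] against the constructed
   [A] gives the upper bound. *)
have [n [nE [[A' [A'n A'cov]] nmin]]] := covering_number_nat finA Acov.
have [n0 lon] := lo _ _ A'n A'cov.
have nN : (n <= N)%N := nmin _ _ AN Acov.
have N0 : (0 < N)%N by exact: leq_trans nN.
have upn : ln n%:R <= a1 * x + c2 / c1 * (x `^ p / p) + ka' * x `^ p.
  by apply: le_trans (Nle N0); rewrite ler_ln ?posrE ?ltr0n// ler_nat.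
have xE : x = c1 `^ (1 / a1) * e `^ (- (1 / a1)) by exact: powR_div_rescale.
have xpE : x `^ p = c1 `^ (p / a1) * e `^ (- (p / a1)).
  by rewrite /x -powRrM div1r [_ * p]mulrC powR_div_rescale.
(* Turns [(c2 / c1) c1^(p / a1)] into the second coefficient of the statement. *)
have cpE : c1 `^ (p / a1) = c1 `^ ((1 - a2) / a1) * c1.
  have -> : p / a1 = (1 - a2) / a1 + 1 by rewrite /p; field; rewrite gt_eqF.
  by rewrite powRD ?(gt_eqF c1_gt0) ?implybT// powRr1// ltW.
have -> : ((fun eps : R => fine (metric_entropy eps (ellipsoid2 mu))) -
  (fun eps : R =>
     a1 * c1 `^ (1 / a1) / ln 2 * eps `^ (- (1 / a1))
     + c2 * c1 `^ ((1 - a2) / a1) / (ln 2 * (a1 - a2 + 1))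
       * eps `^ (- ((a1 - a2 + 1) / a1)))) e =
  (ln n%:R - (a1 * x + c2 / c1 * (x `^ p / p))) / ln 2.
  transitivity (fine (metric_entropy e (ellipsoid2 mu)) -
    (a1 * c1 `^ (1 / a1) / ln 2 * e `^ (- (1 / a1))
     + c2 * c1 `^ ((1 - a2) / a1) / (ln 2 * p) * e `^ (- (p / a1)))); first by [].
  rewrite (metric_entropy_nat n0 nE) xpE cpE xE.
  by field; rewrite !gt_eqF.
rewrite normrM normfV (gtr0_norm ln2) ler_pdivrMr// -/p.
rewrite (ger0_norm (powR_ge0 _ _)).
have -> : ka * e `^ (- (p / a1)) * ln 2 = ka' * x `^ p.
  by rewrite xpE /ka'; field; rewrite gt_eqF.
by rewrite ler_norml; apply/andP; split; move: lon upn; clear; lra.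
Unshelve. all: by end_near. Qed.
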